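(* Let $B_{n+1}$ be the braid group of type $\mathbf{A}_n$, let $X=\{r(\overline{\alpha}) : \alpha\in S_{n+1}\setminus\{1\}\}$ be its Adyan–Thurston generators, let $\Delta=r(s_{11}s_{21}\cdots s_{n1})$, and represent $B_{n+1}$ as a semigroup (with identity $1$, the empty word) by $$B_{n+1}=\mathrm{sgp}\langle X,\ \Delta^{-1}\ |\ \Delta^{\varepsilon}\Delta^{-\varepsilon}=1,\ \varepsilon=\pm1,\ \ r(\overline{\alpha})r(\overline{\beta})=r(\overline{\alpha\beta}),\ \alpha\perp\beta\rangle .$$ A Gröbner–Shirshov basis of $B_{n+1}$ in Adyan–Thurston generator $X$ relative to the deg-lex ordering on $X^*$ is: 1) $r(\overline{\alpha})r(\overline{\beta})=r(\overline{\alpha\beta})$, $\ \alpha\perp\beta$; 2) $r(\overline{\alpha})r(\overline{\beta\gamma})=r(\overline{\alpha\beta})r(\overline{\gamma})$, $\ \alpha\perp\beta\perp\gamma$; 3) $r(\overline{\alpha})\Delta^{\varepsilon}=\Delta^{\varepsilon}r(\overline{\alpha}')$, $\ \overline{\alpha}'=\overline{\alpha}|_{s_i\mapsto s_{n+1-i}}$; 4) $r(\overline{\alpha\beta})r(\overline{\gamma\mu})=\Delta\, r(\overline{\alpha}')r(\overline{\mu})$, $\ \alpha\perp\beta\perp\gamma\perp\mu$, $\ r(\overline{\beta\gamma})=\Delta$; 5) $\Delta^{\varepsilon}\Delta^{-\varepsilon}=1$; where $\varepsilon=\pm1$.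
   Context: $S_{n+1}$ is the symmetric group with generators $s_i=(i,i+1)$, $1\le i\le n$. Put $s_{ji}=s_js_{j-1}\cdots s_i$ for $j\ge i$ and $s_{j,j+1}=1$. Every $\alpha\in S_{n+1}$ equals a unique word $\overline{\alpha}=s_{1i_1}s_{2i_2}\cdots s_{ni_n}$ with $i_j\le j+1$ (its normal form), and $|\overline{\alpha}|$ is the length of this word. Write $\alpha\perp\beta$ if $|\overline{\alpha\beta}|=|\overline{\alpha}|+|\overline{\beta}|$; a chain such as $\alpha\perp\beta\perp\gamma$ means that consecutive elements are related by $\perp$. The symbol $r(\overline{\alpha})$ denotes a letter with index $\overline{\alpha}$. The notation $\overline{\alpha}|_{s_i\mapsto s_{n+1-i}}$ means that each $s_i$ in $\overline{\alpha}$ is replaced by $s_{n+1-i}$. The braid group is $B_{n+1}=\mathrm{gp}\langle\sigma_1,\dots,\sigma_n\mid \sigma_j\sigma_i=\sigma_i\sigma_j\ (j-1>i),\ \sigma_{i+1}\sigma_i\sigma_{i+1}=\sigma_i\sigma_{i+1}\sigma_i\rangle$; it is isomorphic to the group generated by $X$ with relations $r(\overline{\alpha})r(\overline{\beta})=r(\overline{\alpha\beta})$ for $\alpha\perp\beta$, where $r(\overline{\alpha})$ corresponds to the braid obtained from the word $\overline{\alpha}$ by $s_i\mapsto\sigma_i$. Here gp and sgp denote group and semigroup presentations. Ordering: let $s_1<s_2<\cdots<s_n$. Define $r(\overline{\alpha})<r(\overline{\beta})$ if and only if $|\overline{\alpha}|>|\overline{\beta}|$, or $|\overline{\alpha}|=|\overline{\beta}|$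 and $\overline{\alpha}<_{lex}\overline{\beta}$. The deg-lex ordering compares two words first by degree (number of letters) and then lexicographically. Gröbner–Shirshov bases: let $F$ be a field, $F\langle Y\rangle$ the free associative algebra on $Y$, and $Y^*$ the free monoid with a well ordering. For $f\in F\langle Y\rangle$, $\bar f$ is its leading (largest) word; $f$ is monic if $\bar f$ has coefficient 1. For monic $f,g$: if $w=\bar f b=a\bar g$ with $|\bar f|+|\bar g|>|w|$, then $(f,g)_w=fb-ag$ is the intersection composition; if $w=\bar f=a\bar g b$, then $(f,g)_w=f-agb$ is the inclusion composition. For a set $S$ of monic polynomials, a composition $(f,g)_w$ is trivial modulo $(S,w)$ if it equals $\sum c_i a_is_ib_i$ with $c_i\in F$, $a_i,b_i\in Y^*$, $s_i\in S$ and $\overline{a_is_ib_i}<w$. $S$ is a Gröbner–Shirshov basis in $F\langle Y\rangle$ if all compositions of elements of $S$ are trivial. A relation $u=v$ is regarded as the polynomial $u-v$. For a semigroup $A=\mathrm{sgp}\langle Y\mid R\rangle$, a Gröbner–Shirshov basis $R^c$ containing $R$, obtained by repeatedly adding nontrivial compositions to $R$, is called a Gröbner–Shirshov basis of $A$. *)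

(* Defs.v *)
From HB Require Import structures.
From Stdlib Require Import Relation_Operators.
From mathcomp Require Import all_boot all_order all_algebra all_fingroup.
From mathcomp Require Import finmap.
From mathcomp Require Export monalg.

Set Implicit Arguments.
Unset Strict Implicit.
Unset Printing Implicit Defensive.

Import GRing.Theory.

(* Strict lexicographic comparison; a proper prefix is smaller, but only words
   of equal length are ever compared below. *)
Fixpoint lex_lt (T : eqType) (lt : rel T) (u v : seq T) : bool :=
  match u, v with
  | x :: u', y :: v' => lt x y || ((x == y) && lex_lt lt u' v')
  | [::], _ :: _ => true
  | _, [::] => false
  end.

Definition deglex_lt (T : eqType) (lt : rel T) (u v : seq T) : bool :=
  (size u < size v) || ((size u == size v) && lex_lt lt u v).

(* The congruence on Y^* generated by R, so that sgp<Y | R> is the free monoid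
   on Y modulo [thue R]. *)
Definition thue_step (Y : Type) (R : seq Y -> seq Y -> Prop) (u v : seq Y) : Prop :=
  exists a b l r, [/\ R l r, u = a ++ l ++ b & v = a ++ r ++ b].

Definition thue (Y : Type) (R : seq Y -> seq Y -> Prop) : seq Y -> seq Y -> Prop :=
  clos_refl_sym_trans (seq Y) (thue_step R).

Section GroebnerShirshov.
Local Open Scope ring_scope.
Variables (F : fieldType) (Y : choiceType) (lt : rel (seq Y)).

Local Notation free_alg := {malg F[{fmonom Y}]}.

Definition mono (w : seq Y) : free_alg := << FMonom w >>.

(* The empty word, least for deg-lex, is the neutral start of the maximum. *)
Definition lead (f : free_alg) : seq Y :=
  \big[(fun u v => if lt u v then v else u)/[::]]_(m <- msupp f) (m : seq Y).

Definition lcoef (f : free_alg) : F := f@_(FMonom (lead f)).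

Definition monic (f : free_alg) : Prop := lcoef f = 1.

Variant composition (f g : free_alg) (w : seq Y) : free_alg -> Prop :=
  | Intersection a b of w = lead f ++ b & w = a ++ lead g
      & (size w < size (lead f) + size (lead g))%N :
      composition f g w (f * mono b - mono a * g)
  | Inclusion a b of w = lead f & w = a ++ lead g ++ b :
      composition f g w (f - mono a * g * mono b).

(* h is a linear combination of polynomials a s b with s in S whose leading
   words satisfy P. *)
Definition combination (S : free_alg -> Prop) (P : pred (seq Y)) (h : free_alg) : Prop :=
  exists l : seq (F * seq Y * free_alg * seq Y),
    (forall c a s b, (c, a, s, b) \in l ->
       S s /\ P (lead (mono a * s * mono b)))
    /\ h = \sum_(x <- l)
             (let: (c, a, s, b) := x in c *: (mono a * s * mono b)).

Definition trivial_mod (S : free_alg -> Prop) (w : seq Y) : free_alg -> Prop :=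
  combination S (fun v => lt v w).

Definition ideal (S : free_alg -> Prop) : free_alg -> Prop :=
  combination S xpredT.

Definition GS_basis (S : free_alg -> Prop) : Prop :=
  (forall f, S f -> monic f) /\
  (forall f g w h, S f -> S g -> composition f g w h -> trivial_mod S w h).

(* The polynomials u - v of the relations u = v, made monic: the sign changes
   when v is the larger side, and relations between equal words (the zero
   polynomial) contribute nothing. *)
Definition rel_polys (R : seq Y -> seq Y -> Prop) (f : free_alg) : Prop :=
  exists u v, [/\ R u v, u <> v
    & let g := mono u - mono v in f = (lcoef g)^-1 *: g].

(* S is a Groebner-Shirshov basis of sgp<Y | R>.  Passing from R to its
   completion by compositions keeps R and does not change the ideal. *)
Definition GS_basis_of (R S : seq Y -> seq Y -> Prop) : Prop :=
  [/\ GS_basis (rel_polys S),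
      forall f, rel_polys R f -> rel_polys S f
    & forall f, rel_polys S f -> ideal (rel_polys R) f].

End GroebnerShirshov.

Section SymmetricGroup.
Local Open Scope group_scope.
Variable n : nat.

(* Indices are shifted: i : 'I_n stands for the generator s_{i+1}. *)
Definition word_perm (w : seq 'I_n) : 'S_n.+1 :=
  \prod_(i <- w) tperm (inord i) (inord i.+1).

(* s_{j+1} s_j ... s_{i+1}; empty when i = j + 1. *)
Definition desc_word (j i : nat) : seq 'I_n :=
  [seq k : 'I_n <- rev (enum 'I_n) | i <= k <= j].

(* s_{1 i_1} ... s_{n i_n}, where t j is i_{j+1} - 1. *)
Definition nf_word (t : 'I_n -> nat) : seq 'I_n :=
  flatten [seq desc_word j (t j) | j : 'I_n <- enum 'I_n].

(* The normal form; its uniqueness leaves [pick] a single candidate. *)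
Definition nf (a : 'S_n.+1) : seq 'I_n :=
  if [pick t : {ffun 'I_n -> 'I_n.+1} |
        [forall j, t j <= j.+1] && (word_perm (nf_word (fun j => t j)) == a)] is Some t
  then nf_word (fun j => t j) else [::].

Definition perp (a b : 'S_n.+1) : Prop :=
  size (nf (a * b)) = size (nf a) + size (nf b).

Definition w0 : 'S_n.+1 := word_perm (nf_word (fun=> 0)).

(* s_i |-> s_{n+1-i} *)
Definition flip (a : 'S_n.+1) : 'S_n.+1 := word_perm [seq rev_ord i | i <- nf a].

(* [Some a] is r(a), and [None] is Delta^{-1}. *)
Definition letter : choiceType := option {a : 'S_n.+1 | a != 1}.

(* Delta^{-1} is taken least; it has to lie below every r(a) other than Delta
   for r(a) Delta^{-1} to exceed Delta^{-1} r(flip a). *)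
Definition letter_lt (x y : letter) : bool :=
  match x, y with
  | None, y => y != None
  | Some _, None => false
  | Some a, Some b =>
      let u := nf (val a) in let v := nf (val b) in
      (size v < size u)
      || ((size u == size v) && lex_lt (fun i j : 'I_n => i < j) u v)
  end.

(* The one-letter word r(a), with r(1) the empty word; relations that become
   identities this way are dropped by [rel_polys]. *)
Definition r (a : 'S_n.+1) : seq letter :=
  if insub a is Some x then [:: Some x] else [::].

(* Delta^eps, with eps = 1 for true and eps = -1 for false. *)
Definition Delta (eps : bool) : seq letter := if eps then r w0 else [:: None].

Variant AT_pres : seq letter -> seq letter -> Prop :=
  | AT_inv eps : AT_pres (Delta eps ++ Delta (~~ eps)) [::]
  | AT_mul a b of perp a b : AT_pres (r a ++ r b) (r (a * b)).

Variant AT_basis : seq letter -> seq letter -> Prop :=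
  | AT1 a b of perp a b : AT_basis (r a ++ r b) (r (a * b))
  | AT2 a b c of perp a b & perp b c :
      AT_basis (r a ++ r (b * c)) (r (a * b) ++ r c)
  | AT3 a eps : AT_basis (r a ++ Delta eps) (Delta eps ++ r (flip a))
  | AT4 a b c m of perp a b & perp b c & perp c m & r (b * c) = Delta true :
      AT_basis (r (a * b) ++ r (c * m)) (Delta true ++ r (flip a) ++ r m)
  | AT5 eps : AT_basis (Delta eps ++ Delta (~~ eps)) [::].

End SymmetricGroup.

Section BraidGroup.
Variable n : nat.

(* (i, true) is sigma_{i+1} and (i, false) its inverse; B_{n+1} is the set of
   words over these letters modulo [thue braid_rel]. *)
Variant braid_rel : seq ('I_n * bool) -> seq ('I_n * bool) -> Prop :=
  | BraidInv i e : braid_rel [:: (i, e); (i, ~~ e)] [::]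
  | BraidComm (i j : 'I_n) of i.+1 < j :
      braid_rel [:: (j, true); (i, true)] [:: (i, true); (j, true)]
  | BraidBraid (i j : 'I_n) of j = i.+1 :> nat :
      braid_rel [:: (j, true); (i, true); (j, true)]
                [:: (i, true); (j, true); (i, true)].

Definition braid_of_letter (x : letter n) : seq ('I_n * bool) :=
  if x is Some a then [seq (i, true) | i <- nf (val a)]
  else [seq (i, false) | i <- rev (nf (w0 n))].

Definition braid_of (u : seq (letter n)) : seq ('I_n * bool) :=
  flatten [seq braid_of_letter x | x <- u].

(* [braid_of] induces an isomorphism from sgp<letters | R> onto B_{n+1}. *)
Definition presents_braid_group (R : seq (letter n) -> seq (letter n) -> Prop) : Prop :=
  (forall u v, thue R u v <-> thue braid_rel (braid_of u) (braid_of v)) /\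
  (forall w, exists u, thue braid_rel (braid_of u) w).

End BraidGroup.

(* Main.v *)
Require Import Defs.
From mathcomp Require Import all_boot all_algebra all_fingroup finmap zify.
From Stdlib Require Import Relation_Operators Operators_Properties.

(* A binomial system of relations is a Groebner-Shirshov basis as soon as two
   congruent words always have a common reduct under decreasing rewriting
   steps: both monomials of a composition lie below its ambiguity w and are
   congruent.  Common reducts come from the greedy normal form Delta^-k x1...xm.
   In S_{n+1}, ordered by "is a reduced prefix of" (the weak order), two elements
   y, z have a greatest common prefix.  With z = a^-1 w0 this is the largest
   prefix b of y with a _|_ b, and r(a) r(y) -> r(ab) r(b^-1 y) is an instance of
   relation 2.  Sweeping this rule from left to right defines an action of
   simple elements on normal forms; since the head of the product is
   associative, the action respects r(a) r(b) = r(ab) for a _|_ b, and it extends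
   to Delta^-1.  Hence the normal form of a word, computed by letting it act on
   the empty word, depends only on the element of the group, and every word
   reduces to it.

   Relation 4 is harmless even when its right-hand side, having degree 3, is the
   larger one: m is always a prefix of b', so a' _|_ m and both sides reduce to
   Delta r(a'm).

   The presentation itself follows from Matsumoto's theorem. *)

Set Implicit Arguments.
Unset Strict Implicit.
Unset Printing Implicit Defensive.

Import GRing.Theory.

(** * Inversions and the normal form *)

Section Inversions.
Local Open Scope group_scope.
Variable n : nat.
Implicit Types (a b c y z : 'S_n.+1) (i j k : 'I_n) (x : 'I_n.+1).

(* Inversions as ordered pairs in both orders, hence counted twice: this makes
   [inversions (a * b)] a symmetric difference. *)
Definition inversions a : {set 'I_n.+1 * 'I_n.+1} :=
  [set p : 'I_n.+1 * 'I_n.+1 | (p.1 < p.2) != (a p.1 < a p.2)].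

Definition perm_pair a (p : 'I_n.+1 * 'I_n.+1) := (a p.1, a p.2).

Lemma mem_inversionsM a b p :
  (p \in inversions (a * b)) =
  (p \in inversions a) (+) (perm_pair a p \in inversions b).
Proof.
by rewrite !inE /= !permM; do 3 case: (_ < _).
Qed.

Definition twisted a b := [set p in inversions a | perm_pair a p \in inversions b].

(** The inversions of [a * b] are the symmetric difference of those of [a] and the pullback along
    [a] of those of [b]. The intersection is [twisted a b], so lengths add exactly when it is
    empty. *)
Lemma card_inversionsM a b :
  #|inversions (a * b)| + (#|twisted a b|).*2 = #|inversions a| + #|inversions b|.
Proof.
have Hb : #|perm_pair a @^-1: inversions b| = #|inversions b|.
  rewrite on_card_preimset //; exists (perm_pair a^-1) => p _;
  by rewrite /perm_pair /= ?permK ?permKV; case: p.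
have -> : inversions (a * b) = (inversions a :\: perm_pair a @^-1: inversions b)
                      :|: (perm_pair a @^-1: inversions b :\: inversions a).
  by apply/setP=> p; rewrite mem_inversionsM !in_setU !in_setD !in_set;
     do 2 case: (_ != _).
have -> : twisted a b = inversions a :&: perm_pair a @^-1: inversions b.
  by apply/setP=> p; rewrite !inE.
rewrite cardsU -Hb.
set A := inversions a; set B := _ @^-1: _.
have -> : (A :\: B) :&: (B :\: A) = set0.
  by apply/setP=> p; rewrite in_setI !in_setD in_set0; do 2 case: (p \in _).
have := cardsID B A; have := cardsID A B.
rewrite cards0 (setIC B A) subn0 -addnn => <- <-.
by move: #|A :\: B| #|A :&: B| #|B :\: A| => p q r; lia.
Qed.

Lemma inversions1 : inversions 1 = set0.
Proof. by apply/setP=> p; rewrite !inE !perm1 eqxx. Qed.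

Definition lo i : 'I_n.+1 := inord i.
Definition hi i : 'I_n.+1 := inord i.+1.
Definition gen i : 'S_n.+1 := tperm (lo i) (hi i).

Lemma loE i : lo i = i :> nat.
Proof. by rewrite inordK // ltnS ltnW. Qed.

Lemma hiE i : hi i = i.+1 :> nat.
Proof. by rewrite inordK // ltnS. Qed.

Lemma word_permE w : word_perm w = \prod_(i <- w) gen i.
Proof. by []. Qed.

Lemma word_perm_nil : word_perm ([::] : seq 'I_n) = 1.
Proof. by rewrite word_permE big_nil. Qed.

Lemma word_perm_cons i w : word_perm (i :: w) = gen i * word_perm w.
Proof. by rewrite !word_permE big_cons. Qed.

Lemma word_perm_cat (v w : seq 'I_n) :
  word_perm (v ++ w) = word_perm v * word_perm w.
Proof. by rewrite !word_permE big_cat. Qed.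

Lemma word_perm_rcons (w : seq 'I_n) i :
  word_perm (rcons w i) = word_perm w * gen i.
Proof. by rewrite -cats1 word_perm_cat word_perm_cons word_perm_nil mulg1. Qed.

Lemma gen_val i x : gen i x =
  (if x == i :> nat then i.+1 else if x == i.+1 :> nat then i : nat else x) :> nat.
Proof.
have Hl := loE i; have Hh := hiE i; rewrite /gen.
case: tpermP => [->|->|nl nh].
- by rewrite Hl Hh eqxx.
- by rewrite Hl Hh eqxx; case: eqP => //; lia.
- case: eqP => [E|_]; first by case: nl; apply: val_inj; rewrite /= E Hl.
  by case: eqP => [E|//]; case: nh; apply: val_inj; rewrite /= E Hh.
Qed.

Lemma inversions_gen i : inversions (gen i) = [set (lo i, hi i); (hi i, lo i)].
Proof.
apply/setP=> -[u v]; rewrite !inE /= !xpair_eqE -!val_eqE /= !gen_val loE hiE.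
move: (u : nat) (v : nat) (i : nat) => p q m.
have [->|?] := eqVneq p m; have [->|?] := eqVneq q m => //=;
have [Ep|?] := eqVneq p m.+1; have [Eq|?] := eqVneq q m.+1 => //=; lia.
Qed.

Lemma card_inversions_gen i : #|inversions (gen i)| = 2.
Proof.
by rewrite inversions_gen cards2 xpair_eqE -!val_eqE /= loE hiE; lia.
Qed.

Lemma gen_sq i : gen i * gen i = 1.
Proof. exact: tperm2. Qed.

Lemma gen_inv i : (gen i)^-1 = gen i.
Proof. exact: tpermV. Qed.

Lemma gen_fix i x : (x < i) || (i.+1 < x) -> gen i x = x.
Proof.
move=> H; apply: val_inj; rewrite /= gen_val.
by do 2 (case: eqP => [?|_]; first lia).
Qed.

Lemma gen_lo i : gen i (lo i) = hi i. Proof. exact: tpermL. Qed.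
Lemma gen_hi i : gen i (hi i) = lo i. Proof. exact: tpermR. Qed.

(** Right multiplication by [gen i] exchanges two values, found at the positions given by [a^-1];
    left multiplication, as in the next lemmas, exchanges the contents of two positions. *)
Lemma card_inversions_Mgen a i : a^-1 (lo i) < a^-1 (hi i) ->
  #|inversions (a * gen i)| = #|inversions a| + 2.
Proof.
move=> H; have := card_inversionsM a (gen i); rewrite card_inversions_gen.
suff -> : twisted a (gen i) = set0 by rewrite cards0; lia.
apply/setP=> -[u v]; rewrite in_set inversions_gen !inE /= !xpair_eqE.
apply/negP => /andP[Hd /orP[]/andP[/eqP Eu /eqP Ev]]; move: H Hd;
  rewrite -Eu -Ev !permK /= => H; rewrite Eu Ev loE hiE;
  by do 2 case: ltnP => //; lia.
Qed.

Lemma card_inversions_genM_desc y i : y (hi i) < y (lo i) ->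
  #|inversions (gen i * y)| + 2 = #|inversions y|.
Proof.
move=> H; have := card_inversionsM (gen i) y; rewrite card_inversions_gen.
suff -> : twisted (gen i) y = inversions (gen i) by rewrite card_inversions_gen; lia.
apply/setP=> -[u v]; rewrite [in LHS]in_set inversions_gen !inE /= !xpair_eqE.
apply/andP/idP => [[]//|H2]; split=> //.
case/orP: H2 => /andP[/eqP-> /eqP->]; rewrite gen_lo gen_hi;
  by case: ltnP => ?; case: ltnP => //; have := loE i; have := hiE i; lia.
Qed.

Lemma card_inversions_genM_asc y i : y (lo i) < y (hi i) ->
  #|inversions (gen i * y)| = #|inversions y| + 2.
Proof.
move=> H; have := @card_inversions_genM_desc (gen i * y) i.
by rewrite mulgA gen_sq mul1g !permM gen_lo gen_hi => /(_ H).
Qed.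

Lemma card_inversions_word (w : seq 'I_n) :
  #|inversions (word_perm w)| <= (size w).*2.
Proof.
elim: w => [|i w IH]; first by rewrite word_perm_nil inversions1 cards0.
have := card_inversionsM (gen i) (word_perm w).
rewrite word_perm_cons card_inversions_gen [size (_ :: _)]/= doubleS.
by move: #|twisted _ _| (size w) IH => q m; lia.
Qed.

(** * Normal-form words are reduced and represent every permutation *)

Lemma map_val_desc_word (j i : nat) : j < n ->
  map val (desc_word n j i) = rev (iota i (j.+1 - i)).
Proof.
move=> jn; rewrite /desc_word filter_rev map_rev; congr rev.
transitivity [seq k <- iota 0 n | i <= k <= j].
  by rewrite -val_enum_ord filter_map.
apply: (@irr_sorted_eq _ ltn ltn_trans ltnn).
- by rewrite sorted_filter ?iota_ltn_sorted //; apply: ltn_trans.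
- exact: iota_ltn_sorted.
- by move=> k; rewrite mem_filter !mem_iota; lia.
Qed.

Lemma desc_word_empty (j i : nat) : j < n -> j < i -> desc_word n j i = [::].
Proof.
move=> jn ji; apply: (inj_map val_inj); rewrite map_val_desc_word //.
by have -> : j.+1 - i = 0 by lia.
Qed.

Lemma desc_word_rcons (j i : nat) : j < n -> forall k, k = i :> nat -> i <= j ->
  desc_word n j i = rcons (desc_word n j i.+1) k.
Proof.
move=> jn k Ek ij; apply: (inj_map val_inj).
rewrite map_rcons !map_val_desc_word // subSn // /= rev_cons Ek.
by rewrite subSS.
Qed.

Lemma size_desc_word (j i : nat) : j < n -> size (desc_word n j i) = j.+1 - i.
Proof.
by move=> jn; rewrite -(size_map val) map_val_desc_word // size_rev size_iota.
Qed.

(** Descending words grow on the right as i falls, so the induction starts from the empty word at i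
    = j + 1. *)
Lemma desc_word_ind (P : nat -> seq 'I_n -> Prop) (j : nat) : j < n ->
  P j.+1 [::] ->
  (forall (k : 'I_n) w, k <= j -> P k.+1 w -> P k (rcons w k)) ->
  forall i : nat, i <= j.+1 -> P i (desc_word n j i).
Proof.
move=> jn P0 PS i ij; rewrite -(subKn ij).
elim: (j.+1 - i) => [|d IH]; first by rewrite subn0 desc_word_empty.
have [dj|dj] := leqP d j; last first.
  by have -> : j.+1 - d.+1 = j.+1 - d by lia.
have kn : j.+1 - d.+1 < n by lia.
rewrite (@desc_word_rcons _ _ jn (Ordinal kn)) //=; last by lia.
apply: (PS (Ordinal kn)) => /=; first by lia.
by have <- : j.+1 - d = (j.+1 - d.+1).+1 by lia.
Qed.

Lemma word_perm_desc (j i : nat) : j < n -> i <= j.+1 -> forall x,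
  word_perm (desc_word n j i) x =
    (if x == j.+1 :> nat then i else if i <= x <= j then x.+1 else x) :> nat.
Proof.
move=> jn; move: i.
apply: (@desc_word_ind (fun (i : nat) w => forall x,
    word_perm w x = (if x == j.+1 :> nat then i
      else if i <= x <= j then x.+1 else x) :> nat) j jn) => [x|k w kj IH x].
  by rewrite word_perm_nil perm1; case: eqP => // _; case: ifP => //; lia.
rewrite word_perm_rcons permM; move: (IH x).
rewrite gen_val => ->; move: (x : nat) (k : nat) kj => p q qj.
have [E|pj] := eqVneq p j.+1; first by rewrite eqxx; case: eqP => //; lia.
have [qp|qp] := boolP (q < p <= j).
  have -> : q <= p <= j by lia.
  by do 2 (case: eqP => [?|_]; first lia).
have [->|pq] := eqVneq p q; first by rewrite leqnn qj.
have -> : q <= p <= j = false by lia.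
by case: eqP => // ?; lia.
Qed.

(** Invariant while letters are appended: value i sits at position j + 1 and all smaller values at
    positions at most j. The next letter thus exchanges two values in natural order and creates one
    inversion, counted twice. *)
Lemma word_perm_desc_reduced (u : 'S_n.+1) (j i : nat) : j < n -> i <= j.+1 ->
  (forall x, j < x -> u x = x) ->
  #|inversions (u * word_perm (desc_word n j i))| = #|inversions u| + (j.+1 - i).*2.
Proof.
move=> jn ij ufix; move: i ij.
suff H (i : nat) : i <= j.+1 ->
   [/\ (forall x, x = i :> nat -> 
      (u * word_perm (desc_word n j i))^-1 x = hi (Ordinal jn)),
   (forall x, x < i -> (u * word_perm (desc_word n j i))^-1 x <= j) &
   #|inversions (u * word_perm (desc_word n j i))| = #|inversions u| + (j.+1 - i).*2].
  by move=> i /H[].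
have Hh := hiE (Ordinal jn); rewrite /= in Hh.
have ulo x : x <= j -> u^-1 x <= j.
  move=> xj; rewrite leqNgt; apply/negP => /[dup] /ufix.
  by rewrite permKV => <-; lia.
move: i; apply: (@desc_word_ind (fun (i : nat) w =>
   [/\ (forall x, x = i :> nat -> (u * word_perm w)^-1 x = hi (Ordinal jn)),
   (forall x, x < i -> (u * word_perm w)^-1 x <= j) &
   #|inversions (u * word_perm w)| = #|inversions u| + (j.+1 - i).*2]) j jn)
   => [|k w kj [IH1 IH2 IH3]].
  split=> [x Ex|x Ex|].
  - rewrite word_perm_nil mulg1; apply: (@perm_inj _ u); rewrite permKV.
    by rewrite ufix ?Hh //; apply: val_inj; rewrite /= Ex Hh.
  - by rewrite word_perm_nil mulg1; apply: ulo.
  - by rewrite word_perm_nil mulg1; lia.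
have Hl := loE k; have Hk := hiE k.
rewrite word_perm_rcons mulgA; split=> // [x Ex|x Ex|].
- have -> : x = lo k by apply: val_inj; rewrite /= Ex Hl.
  by rewrite invMg gen_inv permM gen_lo IH1.
- by rewrite invMg gen_inv permM gen_fix ?Ex //; apply: IH2; lia.
- rewrite card_inversions_Mgen ?IH3; first by lia.
  by rewrite (IH1 (hi k)) // Hh ltnS IH2 ?Hl.
Qed.

Definition nf_prefix (t : nat -> nat) m : seq 'I_n :=
  flatten [seq desc_word n j (t j) | j : nat <- iota 0 m].

Lemma nf_prefixS t m :
  nf_prefix t m.+1 = nf_prefix t m ++ desc_word n m (t m).
Proof.
by rewrite /nf_prefix -addn1 iotaD map_cat flatten_cat /= cats0.
Qed.

Lemma nf_wordE (t : nat -> nat) :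
  nf_word (fun j : 'I_n => t j) = nf_prefix t n.
Proof. by rewrite /nf_word /nf_prefix -val_enum_ord -map_comp. Qed.

Lemma nf_prefix_fix t m x : m <= n -> (forall j : nat, t j <= j.+1) -> m < x ->
  word_perm (nf_prefix t m) x = x.
Proof.
move=> mn ht; elim: m mn x => [|m IH] mn x mx.
  by rewrite /nf_prefix /= word_perm_nil perm1.
rewrite nf_prefixS word_perm_cat permM IH //; try lia.
apply: val_inj; rewrite /= word_perm_desc //.
have /negPf-> : x != m.+1 :> nat by lia.
have -> // : t m <= x <= m = false by lia.
Qed.

Lemma nf_prefix_reduced t m : m <= n -> (forall j : nat, t j <= j.+1) ->
  #|inversions (word_perm (nf_prefix t m))| = (size (nf_prefix t m)).*2.
Proof.
move=> mn ht; elim: m mn => [|m IH] mn.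
  by rewrite /nf_prefix /= word_perm_nil inversions1 cards0.
rewrite nf_prefixS word_perm_cat word_perm_desc_reduced //.
  by rewrite IH 1?ltnW // size_cat size_desc_word // doubleD.
by move=> x mx; rewrite nf_prefix_fix // ltnW.
Qed.

(** In the inductive step i is the image of the point m + 1, and the last factor is the cycle
    sending m + 1 to i. Dividing it out on the right leaves a permutation that fixes every point
    above m. *)
Lemma nf_prefix_exists m a : m <= n -> (forall x, m < x -> a x = x) ->
  exists2 t, (forall j : nat, t j <= j.+1) & word_perm (nf_prefix t m) = a.
Proof.
elim: m a => [|m IH] a mn ha.
  exists (fun=> 0) => //; rewrite /nf_prefix /= word_perm_nil.
  apply/permP => x; rewrite perm1.
  have [x0|/ha->//] := posnP x.
  have [ax0|/ha/perm_inj//] := posnP (a x).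
  by apply: val_inj; rewrite /= x0 ax0.
have Hh := hiE (Ordinal mn); rewrite /= in Hh.
pose i : nat := a (hi (Ordinal mn)).
have im : i <= m.+1.
  rewrite leqNgt; apply/negP => H; move: (ha _ H).
  by move=> /perm_inj E; move: H; rewrite /i E Hh ltnn.
pose c := word_perm (desc_word n m i).
have [x mx|t ht Et] := IH (a * c^-1) (ltnW mn).
  rewrite permM; apply: (@perm_inj _ c); rewrite permKV.
  have [E|Hx] := eqVneq (x : nat) m.+1.
    apply: val_inj; rewrite /c /= word_perm_desc // E eqxx.
    by rewrite /i; congr (nat_of_ord (a _)); apply: val_inj; rewrite /= E Hh.
  rewrite ha; last by lia.
  apply: val_inj; rewrite /c /= word_perm_desc // (negPf Hx).
  by case: ifP => //; lia.
exists (fun j : nat => if j == m then i else t j) => [j|].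
  by case: eqP => [->|].
rewrite nf_prefixS eqxx word_perm_cat.
have -> : nf_prefix (fun j : nat => if j == m then i else t j) m = nf_prefix t m.
  rewrite /nf_prefix; congr flatten; apply/eq_in_map => j.
  by rewrite mem_iota; case: eqP => // ->; lia.
by rewrite Et -/c mulgKV.
Qed.

(** Every word of normal-form shape is reduced, so any tuple returned by [pick] gives a word whose
    length is half the inversion count; existence excludes the default empty word. *)
Lemma nf_spec a : word_perm (nf a) = a /\ #|inversions a| = (size (nf a)).*2.
Proof.
suff [t [ht Et Ea]] : exists t : nat -> nat,
    [/\ forall j : nat, t j <= j.+1, word_perm (nf_prefix t n) = a
      & nf a = nf_prefix t n].
  by rewrite Ea Et -nf_prefix_reduced ?Et.
rewrite /nf; case: pickP => [t /andP[/forallP ht /eqP Et]|H].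
  pose t' (j : nat) := if insub j is Some k then t k : nat else 0.
  have tE : nf_word (fun j => t j) = nf_prefix t' n.
    rewrite -nf_wordE /nf_word; congr flatten; apply: eq_map => j.
    by rewrite /t' valK.
  exists t'; rewrite -tE; split=> // j; rewrite /t'.
  by case: insubP => // k _ <-.
have [||t ht Et] := @nf_prefix_exists n a => //.
  by move=> x; have := ltn_ord x; lia.
pose t' := [ffun j : 'I_n => inord (t j) : 'I_n.+1].
have := H t'; suff -> : nf_word (fun j => t' j) = nf_prefix t n.
  rewrite Et eqxx andbT => /negP[]; apply/forallP => j.
  by rewrite ffunE inordK //; have := ht j; have := ltn_ord j; lia.
rewrite -nf_wordE /nf_word; congr flatten; apply: eq_map => j.
by rewrite ffunE inordK //; have := ht j; have := ltn_ord j; lia.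
Qed.

Lemma nfK a : word_perm (nf a) = a.
Proof. by case: (nf_spec a). Qed.

Lemma nf_inj : injective (@nf n).
Proof. by move=> a b E; rewrite -[a]nfK E nfK. Qed.

Local Notation len a := (size (nf a)).

Lemma card_inversions a : #|inversions a| = (len a).*2.
Proof. by case: (nf_spec a). Qed.

Lemma lenM a b : len (a * b) <= len a + len b.
Proof. have := card_inversionsM a b; rewrite !card_inversions; lia. Qed.

Lemma len1 : len (1 : 'S_n.+1) = 0.
Proof. by apply: double_inj; rewrite -card_inversions inversions1 cards0. Qed.

Lemma len_eq0 a : (len a == 0) = (a == 1).
Proof.
apply/idP/eqP => [/nilP E|->]; last by rewrite len1.
by rewrite -[a]nfK E word_perm_nil.
Qed.

Lemma len_gen i : len (gen i) = 1%N.
Proof. by apply: double_inj; rewrite -card_inversions card_inversions_gen. Qed.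

Lemma len_word (w : seq 'I_n) : len (word_perm w) <= size w.
Proof. by have := card_inversions_word w; rewrite card_inversions; lia. Qed.

Lemma len_genM_desc y i : y (hi i) < y (lo i) -> len y = (len (gen i * y)).+1.
Proof. move=> /card_inversions_genM_desc; rewrite !card_inversions; lia. Qed.

Lemma len_genM_asc y i : y (lo i) < y (hi i) -> len (gen i * y) = (len y).+1.
Proof. move=> /card_inversions_genM_asc; rewrite !card_inversions; lia. Qed.

Lemma lo_neq_hi y i : y (lo i) != y (hi i) :> nat.
Proof.
apply/eqP => /val_inj /perm_inj /(congr1 val) /=; rewrite loE hiE; lia.
Qed.

Lemma descP y i : (len y = (len (gen i * y)).+1) <-> y (hi i) < y (lo i).
Proof.
split=> [E|]; last exact: len_genM_desc.
have /[!neq_ltn] /orP[/len_genM_asc|//] := lo_neq_hi y i; lia.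
Qed.

(** * The longest element and the flip automorphism *)

Lemma w0E x : w0 n x = n - x :> nat.
Proof.
rewrite /w0 (nf_wordE (fun=> 0)).
(* The first m factors already reverse 0, ..., m; the next cycle shifts these values up by one and
   sends m + 1 to 0. *)
suff H m : m <= n -> forall x : 'I_n.+1, x <= m ->
    word_perm (nf_prefix (fun=> 0) m) x = m - x :> nat.
  by apply: H => //; rewrite -ltnS.
elim: m => [|m IH] mn {}x xm.
  by rewrite /nf_prefix word_perm_nil perm1; lia.
rewrite nf_prefixS word_perm_cat permM word_perm_desc //.
have [Ex|Ex] := eqVneq (x : nat) m.+1.
  by rewrite nf_prefix_fix ?Ex ?eqxx ?subnn // ltnW.
have xm' : x <= m by lia.
rewrite (IH (ltnW mn) _ xm'); have -> : m - x == m.+1 = false by lia.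
have -> : 0 <= m - x <= m by lia.
by rewrite subSn.
Qed.

Lemma w0K : w0 n * w0 n = 1.
Proof.
apply/permP => x; rewrite permM perm1; apply: val_inj; rewrite /= !w0E.
by have := ltn_ord x; lia.
Qed.

Lemma w0V : (w0 n)^-1 = w0 n.
Proof. by apply: (mulgI (w0 n)); rewrite mulgV w0K. Qed.

(** [w0] reverses all pairs, so [a^-1 * w0] reverses exactly the images of the pairs that [a] keeps
    in order; no pair is reversed twice. *)
Lemma len_w0 a : len (w0 n) = len a + len (a^-1 * w0 n).
Proof.
have := card_inversionsM a (a^-1 * w0 n); rewrite mulKVg !card_inversions.
suff -> : twisted a (a^-1 * w0 n) = set0 by rewrite cards0; lia.
apply/setP=> -[u v]; rewrite !inE /= !permM !permK !w0E.
have := ltn_ord u; have := ltn_ord v.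
have : (u == v) = (a u == a v) by rewrite (inj_eq perm_inj).
by rewrite -!val_eqE /=; lia.
Qed.

Lemma gen_rev i : gen (rev_ord i) = gen i ^ w0 n.
Proof.
rewrite /gen tpermJ [RHS]tpermC; have := ltn_ord i => ltin.
congr tperm; apply: val_inj; rewrite /= w0E ?loE ?hiE /=; lia.
Qed.

Lemma flipE a : flip a = a ^ w0 n.
Proof.
rewrite /flip -[in RHS](nfK a); elim: (nf a) => [|i w IH] /=.
  by rewrite word_perm_nil conj1g.
by rewrite !word_perm_cons IH conjMg gen_rev.
Qed.

Lemma flipK : involutive (@flip n).
Proof. by move=> a; rewrite !flipE -conjgM w0K conjg1. Qed.

Lemma flipM a b : flip (a * b) = flip a * flip b.
Proof. by rewrite !flipE conjMg. Qed.

Lemma flip1 : flip 1 = 1 :> 'S_n.+1.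
Proof. by rewrite flipE conj1g. Qed.

Lemma flip_eq1 a : (flip a == 1) = (a == 1).
Proof. by rewrite flipE conjg_eq1. Qed.

Lemma flip_w0 : flip (w0 n) = w0 n.
Proof. by rewrite flipE conjgE mulKg. Qed.

(** [flip] substitutes letters one for one and so never lengthens; being an involution, it preserves
    length. *)
Lemma len_flip a : len (flip a) = len a.
Proof.
suff H b : len (flip b) <= len b by apply/eqP; rewrite eqn_leq H -{1}[a]flipK H.
by rewrite /flip -(size_map (@rev_ord n) (nf b)) len_word.
Qed.

Lemma w0_neq1 : 0 < n -> w0 n != 1.
Proof.
move=> n0; rewrite -len_eq0 (len_w0 (gen (Ordinal n0))) len_gen; lia.
Qed.

End Inversions.

(** * Rewriting and Groebner-Shirshov bases of binomials *)

Section Thue.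
Variables (Y : Type) (R : seq Y -> seq Y -> Prop).

Lemma thue_refl u : thue R u u. Proof. exact: rst_refl. Qed.

Lemma thue_sym u v : thue R u v -> thue R v u. Proof. exact: rst_sym. Qed.

Lemma thue_trans v u w : thue R u v -> thue R v w -> thue R u w.
Proof. exact: rst_trans. Qed.

Lemma thue_ctx a b u v : thue R u v -> thue R (a ++ u ++ b) (a ++ v ++ b).
Proof.
elim=> {u v} [u v [a' [b' [l [r [Rlr -> ->]]]]]|u|u v _|u v w _ IH1 _ IH2].
- by apply: rst_step; exists (a ++ a'), (b' ++ b), l, r; rewrite -!catA.
- exact: thue_refl.
- exact: thue_sym.
- exact: thue_trans IH1 IH2.
Qed.

Lemma thue_rel u v : R u v -> thue R u v.
Proof.
by move=> Ruv; apply: rst_step; exists [::], [::], u, v; rewrite /= !cats0.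
Qed.

Lemma thue_cat u v u' v' : thue R u v -> thue R u' v' ->
  thue R (u ++ u') (v ++ v').
Proof.
move=> /(thue_ctx [::] u') /= H /(thue_ctx v [::]); rewrite !cats0.
exact: thue_trans.
Qed.

Lemma thue_catl a u v : thue R u v -> thue R (a ++ u) (a ++ v).
Proof. exact: (thue_cat (thue_refl a)). Qed.

Lemma thue_catr b u v : thue R u v -> thue R (u ++ b) (v ++ b).
Proof. by move=> H; apply: thue_cat H (thue_refl b). Qed.

Lemma thue_sub (E : seq Y -> seq Y -> Prop) :
  (forall a b u v, E u v -> E (a ++ u ++ b) (a ++ v ++ b)) ->
  (forall u, E u u) -> (forall u v, E u v -> E v u) ->
  (forall u v w, E u v -> E v w -> E u w) ->
  (forall u v, R u v -> E u v) ->
  forall u v, thue R u v -> E u v.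
Proof.
move=> Ectx Erefl Esym Etrans ER u v.
elim=> {u v} [u v [a [b [l [r [Rlr -> ->]]]]]|u|u v _|u v w _ IH1 _ IH2].
- exact/Ectx/ER.
- exact: Erefl.
- exact: Esym.
- exact: Etrans IH1 IH2.
Qed.

End Thue.

Lemma thue_morph (Y Z : Type) (R : seq Y -> seq Y -> Prop)
    (R' : seq Z -> seq Z -> Prop) (f : Y -> seq Z) :
  (forall u v, R u v -> thue R' (flatten (map f u)) (flatten (map f v))) ->
  forall u v, thue R u v -> thue R' (flatten (map f u)) (flatten (map f v)).
Proof.
move=> fR; apply: thue_sub => [a b u v H|u|u v|u v w|//].
- by rewrite !map_cat !flatten_cat; apply: thue_ctx.
- exact: thue_refl.
- exact: thue_sym.
- exact: thue_trans.
Qed.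

Lemma lex_lt_irr (T : eqType) (lt : rel T) : irreflexive lt ->
  irreflexive (lex_lt lt).
Proof. by move=> irr; elim=> //= x u ->; rewrite irr andbF. Qed.

Lemma lex_lt_trans (T : eqType) (lt : rel T) : transitive lt ->
  transitive (lex_lt lt).
Proof.
move=> tr; elim=> [|y v IH] [|x u] [|z w] //=.
case/orP=> [xy|/andP[/eqP-> uv]]; case/orP=> [yz|/andP[/eqP<- vw]].
- by rewrite (tr _ _ _ xy yz).
- by rewrite xy.
- by rewrite yz.
- by rewrite eqxx (IH _ _ uv vw) orbT.
Qed.

Lemma lex_lt_total (T : eqType) (lt : rel T) :
  (forall x y, x != y -> lt x y || lt y x) ->
  forall u v, u != v -> lex_lt lt u v || lex_lt lt v u.
Proof.
move=> tot; elim=> [|x u IH] [|y v] //=; rewrite eqseq_cons negb_and.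
have [<-|/tot/orP[->//|->]] /= := eqVneq x y; last by rewrite orbT.
by move=> /IH/orP[]->; rewrite !orbT.
Qed.

(** * The deg-lex order *)

Section DegLex.
Variables (T : eqType) (lt : rel T).
Hypothesis lt_irr : irreflexive lt.
Hypothesis lt_trans : transitive lt.
Hypothesis lt_total : forall x y, x != y -> lt x y || lt y x.
Local Notation dl := (deglex_lt lt).

Lemma deglex_irr : irreflexive dl.
Proof. by move=> u; rewrite /deglex_lt ltnn eqxx lex_lt_irr. Qed.

Lemma deglex_trans : transitive dl.
Proof.
move=> v u w; rewrite /deglex_lt.
case/orP=> [uv|/andP[/eqP-> uv]]; case/orP=> [vw|/andP[/eqP<- vw]].
- by rewrite (ltn_trans uv vw).
- by rewrite uv.
- by rewrite vw.
- by rewrite eqxx (lex_lt_trans lt_trans uv vw) orbT.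
Qed.

Lemma deglex_total u v : u != v -> dl u v || dl v u.
Proof.
move=> uv; rewrite /deglex_lt.
case: (ltngtP (size u) (size v)) => //= _; exact: lex_lt_total.
Qed.

Lemma deglex_asym u v : dl u v -> dl v u = false.
Proof.
by move=> uv; apply/negP => /(deglex_trans uv); rewrite deglex_irr.
Qed.

Lemma deglex_cat a b u v : dl u v -> dl (a ++ u ++ b) (a ++ v ++ b).
Proof.
have lex_cat x y : size x = size y -> lex_lt lt x y -> lex_lt lt (x ++ b) (y ++ b).
  elim: x y => [|p x IH] [|q y] //= [E] /orP[->//|/andP[-> /(IH _ E)->]].
  by rewrite orbT.
rewrite /deglex_lt !size_cat ltn_add2l ltn_add2r => /orP[->//|].
case/andP=> /eqP Es luv; rewrite Es eqxx orbC /=.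
rewrite (_ : lex_lt _ _ _ = true) //; elim: a => [|x a IH] /=.
  exact: lex_cat.
by rewrite eqxx IH orbT.
Qed.

End DegLex.

(* Stated in an abstract ring because rewriting with ring laws inside
   [{malg F[{fmonom Y}]}] is prohibitively slow. *)
Section RingIdentities.
Local Open Scope ring_scope.
Variable A : pzRingType.
Implicit Types x y z t : A.

Lemma mul_ctxB x y z t : x * (z * y) - x * (t * y) = x * (z - t) * y.
Proof. by rewrite mulrBr mulrBl !mulrA. Qed.

Lemma mul_ctxA x x' y y' z : x * x' * z * (y' * y) = x * (x' * z * y') * y.
Proof. by rewrite !mulrA. Qed.

Lemma mul_swap x y z : x * y = y * x -> x * (y * z) = y * (x * z).
Proof. by rewrite !mulrA => ->. Qed.

Lemma mul_overlap x y z z' t t' :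
  z * y = x * z' -> (z - t) * y - x * (z' - t') = x * t' - t * y.
Proof. by rewrite mulrBl mulrBr => ->; rewrite opprB addrC subrKA. Qed.

End RingIdentities.

(** * Monomials and combinations in the free algebra *)

Section Combinations.
Local Open Scope ring_scope.
Variables (F : fieldType) (Y : choiceType) (lt : rel (seq Y)).
Local Notation free_alg := {malg F[{fmonom Y}]}.
Local Notation mono := (@mono F Y).
Variables (S : free_alg -> Prop) (P : pred (seq Y)).
Local Notation comb := (combination lt S P).

Lemma mono_cat u v : mono (u ++ v) = mono u * mono v.
Proof.
rewrite /mono malgM_def fgmulUU mulr1; congr << _ *g _ >>.
exact: esym (fmmulE (FMonom u) (FMonom v)).
Qed.

Lemma mono_nil : mono [::] = 1.
Proof. by rewrite /mono -fmoneE -mpolyC1E. Qed.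

Lemma mono_scale a (c : F) (f : free_alg) : mono a * (c *: f) = c *: (mono a * f).
Proof.
have E : c%:MP * mono a = mono a * c%:MP.
  by rewrite !malgM_def !fgmulUU mul1r mulr1 mul1m mulm1.
rewrite -(mul_malgC c f) -(mul_malgC c (mono a * f)).
exact: esym (mul_swap f E).
Qed.

Lemma mono_ctxB a b u v : mono (a ++ u ++ b) - mono (a ++ v ++ b) =
  mono a * (mono u - mono v) * mono b.
Proof.
by rewrite !mono_cat; apply: mul_ctxB.
Qed.

Lemma mono_ctxZ a a' b b' (c : F) f :
  mono a * (c *: (mono a' * f * mono b')) * mono b =
  c *: (mono (a ++ a') * f * mono (b' ++ b)).
Proof.
rewrite mono_scale -(fgscaleAl c _ (mono b)) (mono_cat a) (mono_cat b').
apply: (congr1 (fun g => c *: g)).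
exact: esym (mul_ctxA (mono a) (mono a') (mono b) (mono b') f).
Qed.

Lemma combination0 : comb 0.
Proof. by exists [::]; split=> [//|]; rewrite big_nil. Qed.

Lemma combinationD f g : comb f -> comb g -> comb (f + g).
Proof.
move=> [k [Pk ->]] [l [Pl ->]]; exists (k ++ l); split; last by rewrite big_cat.
by move=> c a s b; rewrite mem_cat => /orP[/Pk|/Pl].
Qed.

Lemma combinationN f : comb f -> comb (- f).
Proof.
move=> [l [Pl ->]].
exists [seq (let: (c, a, s, b) := x in (- c, a, s, b)) | x <- l]; split.
  by move=> c a s b /mapP[[[[c' a'] s'] b'] /Pl ? [_ -> -> ->]].
rewrite big_map -sumrN; apply: eq_bigr => -[[[c a] s] b] _.
by rewrite scaleNr.
Qed.

Lemma combination_ctx (a b : seq Y) s :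
  S s -> P (lead lt (mono a * s * mono b)) -> comb (mono a * s * mono b).
Proof.
move=> Ss Ps; exists [:: (1, a, s, b)]; split; last first.
  by rewrite big_seq1 scale1r.
by move=> c a' s' b'; rewrite inE => /eqP[_ -> -> ->].
Qed.

End Combinations.

(** * Confluence and Groebner-Shirshov bases of binomials *)

Section ChurchRosser.
Local Open Scope ring_scope.
Variables (F : fieldType) (Y : choiceType) (lt0 : rel Y).
Hypothesis lt_irr : irreflexive lt0.
Hypothesis lt_trans : transitive lt0.
Hypothesis lt_total : forall x y, x != y -> lt0 x y || lt0 y x.
Local Notation lt := (deglex_lt lt0).
Local Notation free_alg := {malg F[{fmonom Y}]}.
Local Notation mono := (@mono F Y).
Variable (R : seq Y -> seq Y -> Prop).

Lemma lead_max (f : free_alg) u :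
  FMonom u \in msupp f -> (forall m, m \in msupp f -> m != FMonom u -> lt m u) ->
  lead lt f = u.
Proof.
move=> Hu Hs; rewrite /lead.
have {Hu} : FMonom u \in enum_fset (msupp f) by [].
have {Hs} : forall m, m \in enum_fset (msupp f) -> m != FMonom u -> lt m u by [].
move: (enum_fset (msupp f)) => s Hs Hu.
(* No value of the fold over a sublist exceeds [u], the start [[::]] being least; hence the fold
   equals [u] once [u] has been met. *)
have bound t : {subset t <= s} ->
   ~~ lt u (\big[(fun u v => if lt u v then v else u)/[::]]_(m <- t) (m : seq Y)).
  elim: t => [|m t IH] st; first by rewrite big_nil; case: (u).
  rewrite big_cons; case: ifP => _.
    by apply: IH => // x xt; apply: st; rewrite inE xt orbT.
  have [->|mu] := eqVneq m (FMonom u); first by rewrite deglex_irr.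
  by rewrite deglex_asym // Hs // st ?mem_head.
suff main t : {subset t <= s} -> FMonom u \in t ->
    \big[(fun u v => if lt u v then v else u)/[::]]_(m <- t) (m : seq Y) = u.
  exact: (main s).
elim: t => [//|m t IH] st; rewrite inE big_cons.
have st' : {subset t <= s} by move=> x xt; apply: st; rewrite inE xt orbT.
have [<- _|um /= ut] := eqVneq; first by rewrite (negPf (bound _ st')).
by rewrite IH // Hs ?st ?mem_head // eq_sym.
Qed.

Lemma lead_binomial (c : F) u v : c != 0 -> lt v u ->
  lead lt (c *: (mono u - mono v)) = u.
Proof.
move=> c0 vu; have uv : u != v by apply: contraTneq vu => ->; rewrite deglex_irr.
have uv' : (FMonom v == FMonom u) = false.
  by apply/eqP => -[E]; rewrite E eqxx in uv.
apply: lead_max => [|m].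
  rewrite -mcoeff_neq0 mcoeffZ mcoeffB !mcoeffU eqxx uv' subr0 mulr1n.
  by rewrite mulf_neq0 // oner_eq0.
rewrite -mcoeff_neq0 mcoeffZ mcoeffB !mcoeffU => + mu.
rewrite (eq_sym (FMonom u)) (negPf mu) /=; have [<- //|_] := eqVneq (FMonom v) m.
by rewrite subrr mulr0 eqxx.
Qed.

Lemma lead_monoB u v : lt v u -> lead lt (mono u - mono v) = u.
Proof. by move=> vu; have := lead_binomial (oner_neq0 F) vu; rewrite scale1r. Qed.

Lemma lcoef_binomial (c : F) u v : c != 0 -> lt v u ->
  lcoef lt (c *: (mono u - mono v)) = c.
Proof.
move=> c0 vu; rewrite /lcoef lead_binomial // mcoeffZ mcoeffB !mcoeffU eqxx.
have /negPf-> : FMonom v != FMonom u.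
  by apply: contraTneq vu => -[->]; rewrite deglex_irr.
by rewrite subr0 mulr1.
Qed.

Lemma lcoef_monoB u v : lt v u -> lcoef lt (mono u - mono v) = 1.
Proof. by move=> vu; have := lcoef_binomial (oner_neq0 F) vu; rewrite scale1r. Qed.

(** The leading coefficient of [mono u - mono v] is 1 or -1 according to which word is larger, so
    making it monic only orients the relation. *)
Lemma rel_polysP f : rel_polys lt R f <->
  exists l r, [/\ R l r \/ R r l, lt r l & f = mono l - mono r].
Proof.
have normN l r : lt r l ->
    (lcoef lt (mono r - mono l))^-1 *: (mono r - mono l) = mono l - mono r.
  move=> rl; have -> : mono r - mono l = (- 1) *: (mono l - mono r).
    by rewrite scaleN1r opprB.
  rewrite lcoef_binomial ?oppr_eq0 ?oner_eq0 // scalerA.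
  by rewrite mulVf ?oppr_eq0 ?oner_eq0 // scale1r.
have normP l r : lt r l ->
    (lcoef lt (mono l - mono r))^-1 *: (mono l - mono r) = mono l - mono r.
  by move=> rl; rewrite lcoef_monoB // invr1 scale1r.
split=> [[u [v [Ruv /eqP uv /= ->]]]|[l [r [Rlr rl ->]]]].
  have /orP[vu|vu] := deglex_total lt_total uv.
    by exists v, u; split=> //; [right|apply: normN].
  by exists u, v; split=> //; [left|apply: normP].
have lr : l <> r by move=> E; rewrite E deglex_irr in rl.
case: Rlr => Rlr; [exists l, r | exists r, l]; split=> //=; try exact/nesym.
  by rewrite normP.
by rewrite normN.
Qed.

(** A relation is applied only from left to right, and only where that decreases the word; one with
    a larger right side contributes to [rel_polys] but gives no step. *)
Definition red_step u v := exists a b l r,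
  [/\ R l r, lt r l, u = a ++ l ++ b & v = a ++ r ++ b].

Definition red := clos_refl_trans (seq Y) red_step.

Lemma red_refl u : red u u. Proof. exact: rt_refl. Qed.

Lemma red_trans v u w : red u v -> red v w -> red u w.
Proof. exact: rt_trans. Qed.

Lemma red_ctx a b u v : red u v -> red (a ++ u ++ b) (a ++ v ++ b).
Proof.
elim=> {u v} [u v [a' [b' [l [r [Rlr rl -> ->]]]]]|u|u v w _ IH1 _ IH2].
- by apply: rt_step; exists (a ++ a'), (b' ++ b), l, r; rewrite -!catA.
- exact: red_refl.
- exact: red_trans IH1 IH2.
Qed.

Lemma red_rel l r : R l r -> lt r l -> red l r.
Proof.
by move=> Rlr rl; apply: rt_step; exists [::], [::], l, r; rewrite /= !cats0.
Qed.

Local Notation S := (rel_polys lt R : free_alg -> Prop).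

(** The difference telescopes along the reduction: each step adds one polynomial of [S] in a
    context, whose leading word is the word being rewritten. *)
Lemma combination_red w u v : red u v -> lt u w ->
  trivial_mod lt S w (mono u - mono v) /\ lt v w.
Proof.
move=> uv; have {uv} := clos_rt_rt1n _ _ _ _ uv.
elim=> {u v} [u uw|u v z [a [b [l [r [Rlr rl -> ->]]]]] _ IH].
  by rewrite subrr; split=> //; apply: combination0.
move=> uw; have vu := deglex_cat a b rl.
have vw : lt (a ++ r ++ b) w := deglex_trans lt_trans vu uw.
have [vz zw] := IH vw; split; last exact: zw.
rewrite -(subrKA (mono (a ++ r ++ b))); apply: combinationD vz.
have E := mono_ctxB F a b l r.
rewrite E; apply: combination_ctx.
  by apply/rel_polysP; exists l, r; split=> //; left.
by rewrite -E lead_monoB.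
Qed.

(** Membership of [mono u - mono v] in the ideal is itself a congruence containing [R]. *)
Lemma ideal_thue u v : thue R u v -> ideal lt S (mono u - mono v).
Proof.
rewrite /ideal.
move: u v; apply: thue_sub => [a b u v [l [Pl E]]|u|u v|u v w|u v Ruv].
- rewrite mono_ctxB.
  exists [seq (let: (c, a', s, b') := x in (c, a ++ a', s, b' ++ b)) | x <- l].
  split.
    move=> c a' s b' /mapP[[[[c' a''] s'] b''] /Pl [? _] [_ _ -> _]].
    by split.
  rewrite E mulr_sumr mulr_suml big_map; apply: eq_bigr => -[[[c a'] s] b'] _.
  exact: mono_ctxZ.
- by rewrite subrr; apply: combination0.
- by move=> H; rewrite -opprB; apply: combinationN H.
- by move=> uv vw; rewrite -(subrKA (mono v)); apply: combinationD uv vw.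
have [->|/eqP uv] := u =P v; first by rewrite subrr; apply: combination0.
have E : mono u - mono v = mono [::] * (mono u - mono v) * mono [::].
  by rewrite mono_nil mul1r mulr1.
have /orP[lt_uv|lt_vu] := deglex_total lt_total uv.
  rewrite -opprB; apply: combinationN.
  have -> : mono v - mono u = mono [::] * (mono v - mono u) * mono [::].
    by rewrite mono_nil mul1r mulr1.
  by apply: combination_ctx => //; apply/rel_polysP; exists v, u; split=> //; right.
rewrite E; apply: combination_ctx => //; apply/rel_polysP.
by exists u, v; split=> //; left.
Qed.

Lemma GS_basis_confluent :
  (forall u v, thue R u v -> exists2 w, red u w & red v w) -> GS_basis lt S.
Proof.
move=> CR; split=> [f /rel_polysP[l [r [_ rl ->]]]|f g w h].
  exact: lcoef_monoB.
have thue_or l r : R l r \/ R r l -> thue R l r.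
  by case=> [|/thue_rel/thue_sym//]; apply: thue_rel.
have main u v : lt u w -> lt v w -> thue R u v ->
    trivial_mod lt S w (mono u - mono v).
  move=> uw vw /CR[z /combination_red/(_ uw)[Hu _] /combination_red/(_ vw)[Hv _]].
  rewrite -(subrKA (mono z)); apply: combinationD Hu _.
  by rewrite -opprB; apply: combinationN.
move=> /rel_polysP[l [r [/thue_or Rf rl Ef]]].
move=> /rel_polysP[l' [r' [/thue_or Rg rl' Eg]]].
have lf : lead lt f = l by rewrite Ef lead_monoB.
have lg : lead lt g = l' by rewrite Eg lead_monoB.
case=> a b; rewrite lf lg => Ew Ew'; rewrite Ef Eg.
  (* The two copies of [w] cancel, leaving the difference of the two words obtained by rewriting [w]
     at either place. *)
  move=> _; have -> : (mono l - mono r) * mono b - mono a * (mono l' - mono r')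
     = mono (a ++ r') - mono (r ++ b).
    have E : mono l * mono b = mono a * mono l'.
      by rewrite -(mono_cat F l b) -(mono_cat F a l') -Ew -Ew'.
    rewrite (mono_cat F a r') (mono_cat F r b).
    exact: (mul_overlap (mono r) (mono r') E).
  apply: main.
  - by rewrite Ew'; have := deglex_cat a [::] rl'; rewrite !cats0.
  - by rewrite Ew; apply: (deglex_cat [::] b rl).
  - apply: (@thue_trans _ _ (a ++ l')); first exact/thue_catl/thue_sym.
    by rewrite -Ew' Ew; apply: thue_catr.
have -> : (mono l - mono r) - mono a * (mono l' - mono r') * mono b
   = mono (a ++ r' ++ b) - mono r.
  rewrite -mono_ctxB -Ew' Ew; move: (mono _) (mono _) (mono _) => x y z.
  by rewrite opprB addrC subrKA.
apply: main.
- by rewrite Ew'; apply: deglex_cat.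
- by rewrite Ew.
- apply: (@thue_trans _ _ (a ++ l' ++ b)); first exact/thue_ctx/thue_sym.
  by rewrite -Ew' Ew.
Qed.

End ChurchRosser.

(** * Weak order *)

Section WeakOrder.
Local Open Scope group_scope.
Variable n : nat.
Implicit Types (a b c x y z : 'S_n.+1) (i j k : 'I_n).
Local Notation len a := (size (nf a)).

Definition prefix_of a y := len y == (len a + len (a^-1 * y))%N.

Lemma perpP a b : perp a b <-> prefix_of a (a * b).
Proof. by rewrite /perp /prefix_of mulKg; split=> [->|/eqP]. Qed.

Lemma perp_quot a y : prefix_of a y -> perp a (a^-1 * y).
Proof. by move=> H; apply/perpP; rewrite mulKVg. Qed.

Lemma prefix_mul a x y : perp a x -> prefix_of a y ->
  prefix_of (a * x) y = prefix_of x (a^-1 * y).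
Proof.
rewrite /perp /prefix_of => ax /eqP ay; rewrite ax ay invMg -mulgA -addnA.
by rewrite eqn_add2l.
Qed.

Lemma lenM_eq a b c : c = a * b -> len c <= len a + len b.
Proof. by move=> ->; apply: lenM. Qed.

Lemma prefix_quot a x y : prefix_of a y -> prefix_of x (a^-1 * y) -> perp a x.
Proof.
rewrite /perp /prefix_of => /eqP ay /eqP xy.
have := @lenM_eq (a * x) (x^-1 * (a^-1 * y)) y; rewrite -mulgA !mulKVg.
by move=> /(_ erefl); have := lenM a x; lia.
Qed.

Lemma prefix_trans y x z : prefix_of x y -> prefix_of y z -> prefix_of x z.
Proof.
rewrite /prefix_of => /eqP xy /eqP yz.
have := @lenM_eq (x^-1 * y) (y^-1 * z) (x^-1 * z); rewrite -mulgA !mulKVg.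
move=> /(_ erefl); have := @lenM_eq x (x^-1 * z) z; rewrite mulKVg => /(_ erefl).
lia.
Qed.

Lemma prefix_refl a : prefix_of a a.
Proof. by rewrite /prefix_of mulVg len1 addn0. Qed.

Lemma prefix1 a : prefix_of 1 a.
Proof. by rewrite /prefix_of invg1 mul1g len1. Qed.

Lemma prefix_anti a b : prefix_of a b -> prefix_of b a -> a = b.
Proof.
rewrite /prefix_of => /eqP ab /eqP ba.
have /eqP : len (a^-1 * b) = 0 by lia.
by rewrite len_eq0 => /eqP E; rewrite -[RHS](mulKVg a) E mulg1.
Qed.

Lemma perp1r a : perp a 1. Proof. by rewrite /perp mulg1 len1 addn0. Qed.
Lemma perp1l a : perp 1 a. Proof. by rewrite /perp mul1g len1. Qed.

Lemma perp_assoc a b c : perp a b ->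
  (perp (a * b) c <-> perp b c /\ perp a (b * c)).
Proof.
have E : a * (b * c) = a * b * c by rewrite mulgA.
rewrite /perp => ab; have := lenM a (b * c); have := lenM b c.
by rewrite E; split=> [|[]]; lia.
Qed.

Lemma prefix_w0 a : prefix_of a (w0 n).
Proof. by rewrite /prefix_of (len_w0 a). Qed.

(** Every [a * x] is a prefix of [w0]; cancelling [a] turns additivity of lengths into membership in
    a weak-order interval, to which meets apply. *)
Lemma perp_w0P a x : perp a x <-> prefix_of x (a^-1 * w0 n).
Proof.
split=> [ax|]; last by apply: prefix_quot; apply: prefix_w0.
by rewrite -prefix_mul ?prefix_w0.
Qed.

Lemma prefix_gen i y : prefix_of (gen i) y = (y (hi i) < y (lo i)).
Proof.
rewrite /prefix_of len_gen gen_inv; apply/eqP/idP => [E|/len_genM_desc //].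
by apply/descP.
Qed.

Lemma len_prefix_gen i y : prefix_of (gen i) y -> len y = (len (gen i * y)).+1.
Proof. by rewrite prefix_gen => /len_genM_desc. Qed.

Lemma first_letter x : x != 1 -> exists i, prefix_of (gen i) x.
Proof.
case E : (nf x) => [|i w]; first by rewrite -len_eq0 E.
move=> _; exists i; have Ex := nfK x; rewrite E word_perm_cons in Ex.
have Ew : gen i * x = word_perm w by rewrite -Ex mulgA gen_sq mul1g.
rewrite /prefix_of gen_inv len_gen Ew E /=; have := len_word w.
have := @lenM_eq (gen i) (word_perm w) x (esym Ex).
by rewrite len_gen E /=; lia.
Qed.

(** * Reduced words, Matsumoto's theorem and meets *)

Local Notation braid := (thue (@braid_rel n)).
Definition pos (w : seq 'I_n) := [seq (i, true) | i <- w].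

Definition reduced (w : seq 'I_n) := len (word_perm w) = size w.

Lemma reduced_prefix (w : seq 'I_n) y :
  len y = (len ((word_perm w)^-1 * y) + size w)%N ->
  reduced w /\ prefix_of (word_perm w) y.
Proof.
move=> E; rewrite /prefix_of /reduced; have := len_word w.
by have := lenM (word_perm w) ((word_perm w)^-1 * y); rewrite mulKVg; lia.
Qed.

Lemma join_comm i j : i.+1 < j ->
  word_perm [:: i; j] = word_perm [:: j; i] /\
  forall y, prefix_of (gen i) y -> prefix_of (gen j) y ->
    reduced [:: i; j] /\ prefix_of (word_perm [:: i; j]) y.
Proof.
move=> ij; have Hlj := loE j; have Hhj := hiE j.
have fix_lo : gen i (lo j) = lo j by apply: gen_fix; rewrite Hlj; lia.
have fix_hi : gen i (hi j) = hi j by apply: gen_fix; rewrite Hhj; lia.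
split.
  rewrite !word_perm_cons word_perm_nil !mulg1 [RHS]conjgC; congr (_ * _).
  by rewrite tpermJ fix_lo fix_hi.
move=> y iy jy; apply: reduced_prefix.
have jiy : prefix_of (gen j) (gen i * y).
  by rewrite prefix_gen !permM fix_lo fix_hi -prefix_gen.
have -> : (word_perm [:: i; j])^-1 * y = gen j * (gen i * y).
  by rewrite !word_perm_cons word_perm_nil mulg1 invMg !gen_inv -mulgA.
by rewrite (len_prefix_gen iy) (len_prefix_gen jiy) /=; lia.
Qed.

(** Descents at i and i + 1 make [y] decreasing on three consecutive points, so dividing by the
    three letters in turn shortens it each time. *)
Lemma join_braid i j : j = i.+1 :> nat ->
  word_perm [:: i; j; i] = word_perm [:: j; i; j] /\
  forall y, prefix_of (gen i) y -> prefix_of (gen j) y ->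
    reduced [:: i; j; i] /\ prefix_of (word_perm [:: i; j; i]) y.
Proof.
move=> Ej; have Hli := loE i; have Hlj := loE j.
have Hhi := hiE i; have Hhj := hiE j.
have Elo : lo j = hi i by apply: val_inj; rewrite /= Hlj Hhi Ej.
have gi_hj : gen i (hi j) = hi j by apply: gen_fix; rewrite Hhj; lia.
have gj_li : gen j (lo i) = lo i by apply: gen_fix; rewrite Hli; lia.
have gj_hi : gen j (hi i) = hi j by rewrite -Elo gen_lo.
have gj_hj : gen j (hi j) = hi i by rewrite gen_hi.
split.
  rewrite !word_perm_cons word_perm_nil !mulg1 !mulgA.
  have -> : gen i * gen j * gen i = gen j ^ gen i by rewrite conjgE gen_inv mulgA.
  have -> : gen j * gen i * gen j = gen i ^ gen j by rewrite conjgE gen_inv mulgA.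
  by rewrite {1 3}/gen !tpermJ Elo gen_hi gi_hj gj_hi gj_li.
move=> y iy jy; apply: reduced_prefix.
move: (iy) (jy); rewrite !prefix_gen Elo => Yi Yj.
have jiy : prefix_of (gen j) (gen i * y).
  by rewrite prefix_gen !permM Elo gen_hi gi_hj; lia.
have ijiy : prefix_of (gen i) (gen j * (gen i * y)).
  by rewrite prefix_gen !permM gj_hi gj_li gi_hj gen_lo.
have -> : (word_perm [:: i; j; i])^-1 * y = gen i * (gen j * (gen i * y)).
  by rewrite !word_perm_cons word_perm_nil mulg1 !invMg !gen_inv -!mulgA.
by rewrite (len_prefix_gen iy) (len_prefix_gen jiy) (len_prefix_gen ijiy) /=; lia.
Qed.

(* The common upper bound of two generators is the longest element of the
   rank two parabolic subgroup they span. *)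
Lemma join_gens i j : i != j -> exists p q : seq 'I_n,
  [/\ braid (pos (i :: p)) (pos (j :: q)),
      word_perm (i :: p) = word_perm (j :: q),
      size q = size p
    & forall y, prefix_of (gen i) y -> prefix_of (gen j) y ->
        reduced (i :: p) /\ prefix_of (word_perm (i :: p)) y].
Proof.
suff H i' j' : i' < j' -> exists p q : seq 'I_n,
  [/\ braid (pos (i' :: p)) (pos (j' :: q)),
      word_perm (i' :: p) = word_perm (j' :: q),
      size q = size p
    & forall y, prefix_of (gen i') y -> prefix_of (gen j') y ->
        reduced (i' :: p) /\ prefix_of (word_perm (i' :: p)) y].
  rewrite -val_eqE /= neq_ltn => /orP[/H//|/H[p [q [Hb Hw Hs Hy]]]].
  exists q, p; split=> //; first exact: thue_sym.
  move=> y Hi Hj; rewrite -Hw; have [Hr Hp] := Hy _ Hj Hi.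
  by split=> //; rewrite /reduced -Hw Hr /= Hs.
rewrite leq_eqVlt => /orP[/eqP Ej|ij].
  have [Ew Hy] := join_braid (esym Ej); exists [:: j'; i'], [:: i'; j'].
  split; [|exact: Ew|exact: erefl|exact: Hy].
  by apply: thue_sym; apply: thue_rel; apply: BraidBraid.
have [Ew Hy] := join_comm ij; exists [:: j'], [:: i'].
split; [|exact: Ew|exact: erefl|exact: Hy].
by apply: thue_sym; apply: thue_rel; apply: BraidComm.
Qed.

Lemma reduced_nf a : reduced (nf a).
Proof. by rewrite /reduced nfK. Qed.

Lemma genM_word k v : gen k * word_perm (k :: v) = word_perm v.
Proof. by rewrite word_perm_cons mulgA gen_sq mul1g. Qed.

Lemma reduced_cons k v : reduced (k :: v) ->
  reduced v /\ prefix_of (gen k) (word_perm (k :: v)).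
Proof.
rewrite /reduced /prefix_of gen_inv genM_word len_gen => Er; have := len_word v.
by have := lenM (gen k) (word_perm v); rewrite -word_perm_cons len_gen Er /=; lia.
Qed.

(* Matsumoto's theorem. *)
Lemma reduced_braid (w w' : seq 'I_n) : reduced w -> reduced w' ->
  word_perm w = word_perm w' -> braid (pos w) (pos w').
Proof.
have [m] := ubnP (size w); elim: m w w' => // m IH [|i u] w' /=.
  move=> _ _; rewrite /reduced word_perm_nil => rw' E; move: rw'.
  by rewrite -E len1; case: w' {E} => // *; apply: thue_refl.
rewrite ltnS => um rw rw'; rewrite /reduced in rw rw'.
case: w' rw' => [|j u'] rw' E; first by move: rw; rewrite E rw'.
have [ru iy] := reduced_cons rw; have [ru' jy] := reduced_cons rw'.
have [Eij|ij] := eqVneq i j.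
  rewrite -Eij in E *; apply: (thue_catl [:: (i, true)]).
  by apply: IH => //; rewrite -(genM_word i u) E genM_word.
(* Both letters are prefixes of [y], hence so is their join [d], spelled [i :: p] or [j :: q]. With
   [v] spelling the rest of [y], the words are linked through [i :: p ++ v] and [j :: q ++ v]: the
   outer links share a first letter and follow by induction, the middle one is [Hb]. *)
have [p [q [Hb Hd Hs Hy]]] := join_gens ij.
set y := word_perm (i :: u) in rw rw' E iy jy.
rewrite -E in rw' jy; have [ld dy] := Hy _ iy jy.
have {}ld : len (word_perm (i :: p)) = (size p).+1 := ld.
set d := word_perm (i :: p) in Hd ld dy.
pose v := nf (d^-1 * y).
have step k s t : size t = size p -> word_perm (k :: t) = d -> size s < m ->
    word_perm (k :: s) = y -> len y = (size s).+1 -> reduced s ->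
    braid (pos (k :: s)) (pos (k :: t) ++ pos v).
  move=> st dt sm Ey ly rs; suff: braid (pos s) (pos (t ++ v)).
    by move/(thue_catl [:: (k, true)]); rewrite {2}/pos map_cat.
  have Es : word_perm s = word_perm (t ++ v).
    rewrite word_perm_cat nfK -(genM_word k s) -(genM_word k t) Ey dt.
    by rewrite -mulgA mulKVg.
  apply: IH => //; rewrite /reduced -Es rs size_cat st.
  by move: dy; rewrite /prefix_of ly ld -/v; lia.
apply: (@thue_trans _ _ (pos (i :: p) ++ pos v)); first exact: step.
apply: (@thue_trans _ _ (pos (j :: q) ++ pos v)); first exact: thue_catr.
by apply: thue_sym; apply: step => //; move: rw rw'; rewrite /=; lia.
Qed.

(** Dividing both elements by a common first letter and using induction yields the greatest common
    prefix beginning with that letter. It remains to see that it also dominates the common prefixes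
    beginning with other letters. *)
Lemma meet_exists y z : exists b, [/\ prefix_of b y, prefix_of b z
  & forall x, prefix_of x y -> prefix_of x z -> prefix_of x b].
Proof.
have [m] := ubnP (len y); elim: m y z => // m IH y z; rewrite ltnS => ym.
have IHgen i : prefix_of (gen i) y -> prefix_of (gen i) z ->
    exists B, [/\ prefix_of (gen i) B, prefix_of B y, prefix_of B z &
     forall x, prefix_of (gen i) x -> prefix_of x y -> prefix_of x z ->
       prefix_of x B].
  move=> iy iz; have ly := len_prefix_gen iy.
  have [|b [by_ bz Hb]] := IH (gen i * y) (gen i * z); first by lia.
  have ib : perp (gen i) b by apply: (prefix_quot iy); rewrite gen_inv.
  have iB : prefix_of (gen i) (gen i * b) by apply/perpP.
  have prefE x w : prefix_of (gen i) x -> prefix_of (gen i) w ->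
      prefix_of x w = prefix_of (gen i * x) (gen i * w).
    move=> ix; have pix := perp_quot ix; rewrite gen_inv in pix => iw.
    rewrite -{1}[x]mul1g -(gen_sq i) -mulgA.
    by rewrite (prefix_mul pix iw) gen_inv.
  have E : gen i * (gen i * b) = b by rewrite mulgA gen_sq mul1g.
  exists (gen i * b); split; first exact: iB.
  - by rewrite (prefE _ _ iB iy) E.
  - by rewrite (prefE _ _ iB iz) E.
  move=> x ix; rewrite (prefE _ _ ix iy) (prefE _ _ ix iz) (prefE _ _ ix iB) E.
  exact: Hb.
have [/existsP[i /andP[iy iz]]|none] :=
    boolP [exists i, prefix_of (gen i) y && prefix_of (gen i) z]; last first.
  exists 1; split; rewrite ?prefix1 // => x xy xz.
  have [->|/first_letter[i ix]] := eqVneq x 1; first exact: prefix1.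
  case/negP: none; apply/existsP; exists i.
  by rewrite (prefix_trans ix xy) (prefix_trans ix xz).
have [B [iB By Bz HB]] := IHgen _ iy iz; exists B.
split; [exact: By|exact: Bz|move=> x xy xz].
have [->|/first_letter[j jx]] := eqVneq x 1; first exact: prefix1.
have [ij|ij] := eqVneq i j; first by rewrite -ij in jx; exact: HB jx xy xz.
have jy := prefix_trans jx xy; have jz := prefix_trans jx xz.
have [B' [jB' B'y B'z HB']] := IHgen _ jy jz.
apply: (prefix_trans (HB' _ jx xy xz)).
(* The join [d] of the two generators is a common prefix beginning with s_j, hence below [B']. It
   also begins with s_i, so [B'] does too and therefore lies below [B]. *)
have [p [q [_ Ed Hs Hd]]] := join_gens ij.
have [_ dy] := Hd _ iy jy; have [_ dz] := Hd _ iz jz.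
set d := word_perm (i :: p) in Ed dy dz.
have [ld _] := Hd _ iy jy.
have [_ id] : reduced p /\ prefix_of (gen i) d by apply: reduced_cons.
have [_ jd] : reduced q /\ prefix_of (gen j) d.
  by rewrite Ed; apply: reduced_cons; rewrite /reduced -Ed -/d ld /= Hs.
exact: HB (prefix_trans id (HB' _ jd dy dz)) B'y B'z.
Qed.

End WeakOrder.

(** * Greedy normal forms *)

Section Greedy.
Local Open Scope group_scope.
Variable n : nat.
Implicit Types (a b c q x y z : 'S_n.+1) (s : seq 'S_n.+1).
Local Notation len a := (size (nf a)).

Definition meet y z : 'S_n.+1 :=
  odflt 1 [pick b | [&& prefix_of b y, prefix_of b z
    & [forall x, prefix_of x y && prefix_of x z ==> prefix_of x b]]].

Lemma meetP y z : [/\ prefix_of (meet y z) y, prefix_of (meet y z) z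
  & forall x, prefix_of x y -> prefix_of x z -> prefix_of x (meet y z)].
Proof.
rewrite /meet; case: pickP => [b /and3P[yb zb /forallP Hb]|none] /=.
  split=> // x xy xz; have := Hb x; rewrite xy xz; exact.
have [b [yb zb Hb]] := meet_exists y z; case/negP: (none b).
rewrite yb zb; apply/forallP => x; apply/implyP => /andP[]; exact: Hb.
Qed.

(* The part of y that the greedy normal form of a y moves into a. *)
Definition beta a y := meet (a^-1 * w0 n) y.

Lemma beta_spec a y : [/\ perp a (beta a y), prefix_of (beta a y) y
  & forall x, perp a x -> prefix_of x y -> prefix_of x (beta a y)].
Proof.
have [H1 H2 H3] := meetP (a^-1 * w0 n) y; split=> [||x /perp_w0P ax xy].
- exact/perp_w0P.
- exact: H2.
- exact: H3.
Qed.

Lemma beta_uniq a y b : perp a b -> prefix_of b y ->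
  (forall x, perp a x -> prefix_of x y -> prefix_of x b) -> beta a y = b.
Proof.
move=> ab yb Hb; have [ac yc Hc] := beta_spec a y; apply: prefix_anti.
  exact: Hb.
exact: Hc.
Qed.

Lemma beta_perp a y : perp a y -> beta a y = y.
Proof. move=> ay; apply: beta_uniq => //; exact: prefix_refl. Qed.

Lemma beta_w0l y : beta (w0 n) y = 1.
Proof.
apply: beta_uniq; [exact: perp1r|exact: prefix1|move=> x].
by move/perp_w0P; rewrite mulVg.
Qed.

Lemma beta_w0r a : beta a (w0 n) = a^-1 * w0 n.
Proof.
apply: beta_uniq; last by move=> x /perp_w0P.
  by apply/perp_w0P/prefix_refl.
exact: prefix_w0.
Qed.

Definition ghead a y := a * beta a y.
Definition gtail a y := (beta a y)^-1 * y.

Lemma ghead_gtail a y : ghead a y * gtail a y = a * y.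
Proof. by rewrite /ghead /gtail -mulgA mulKVg. Qed.

Lemma len_ghead_gtail a y : (len (ghead a y) + len (gtail a y) = len a + len y)%N.
Proof.
have [ab by_ _] := beta_spec a y; rewrite /ghead /gtail ab.
by move/eqP: by_ => ->; rewrite addnA.
Qed.

(** With c the factor moved into b, the largest prefix d of b c that a can absorb contains b,
    because a absorbs b. Writing d = b e, it remains to show that e is the largest prefix of y that
    a b can absorb. *)
Lemma gheadM a b y : perp a b -> ghead (a * b) y = ghead a (ghead b y).
Proof.
move=> ab; rewrite /ghead -mulgA; congr (_ * _).
have [pb yb Hb] := beta_spec b y; set c := beta b y in pb yb Hb *.
have [pa ya Ha] := beta_spec a (b * c); set d := beta a _ in pa ya Ha *.
have bd : prefix_of b d by apply: Ha; [exact: ab|exact/perpP].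
have Ed : b * (b^-1 * d) = d by rewrite mulKVg.
have pbd := perp_quot bd; set e := b^-1 * d in Ed pbd.
have prefE x : perp b x -> prefix_of (b * x) (b * c) = prefix_of x c.
  by move=> bx; rewrite prefix_mul ?mulKg //; apply/perpP.
suff -> : beta (a * b) y = e by [].
rewrite -Ed in pa ya Ha; apply: beta_uniq.
- exact/(perp_assoc _ ab).
- by apply: prefix_trans yb; rewrite -prefE.
(* For a competitor x, maximality of c places b x below b c, then maximality of d places it below b
   e, and b cancels. *)
move=> x /(perp_assoc _ ab)[bx abx] xy.
have bxc : prefix_of (b * x) (b * c) by rewrite (prefE x bx); apply: Hb.
have bbe : prefix_of b (b * e) by apply/perpP.
by have := Ha _ abx bxc; rewrite (prefix_mul bx bbe) mulKg.
Qed.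

(** The heads agree by [gheadM], so cancelling them from a b y gives the product formula. Lengths
    add because passing to head and tail preserves total length. *)
Lemma gtailM a b y : perp a b ->
  perp (gtail a (ghead b y)) (gtail b y) /\
  gtail a (ghead b y) * gtail b y = gtail (a * b) y.
Proof.
move=> ab; have E : gtail a (ghead b y) * gtail b y = gtail (a * b) y.
  apply: (mulgI (ghead (a * b) y)); rewrite ghead_gtail gheadM // mulgA.
  by rewrite ghead_gtail -mulgA ghead_gtail mulgA.
split=> //; rewrite /perp E.
have := len_ghead_gtail (a * b) y; have := len_ghead_gtail a (ghead b y).
by have := len_ghead_gtail b y; rewrite -gheadM // ab; lia.
Qed.

(* Left multiplication by a simple element on greedy normal forms. *)
Fixpoint greedy_act a s : seq 'S_n.+1 :=
  if s is x :: s' then ghead a x :: greedy_act (gtail a x) s'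
  else if a == 1 then [::] else [:: a].

Lemma greedy_act1 s : greedy_act 1 s = s.
Proof.
elim: s => [|x s IH] /=; first by rewrite eqxx.
by rewrite /gtail /ghead beta_perp ?mulVg ?IH ?mul1g //; apply: perp1l.
Qed.

Lemma greedy_actM a b s : perp a b ->
  greedy_act a (greedy_act b s) = greedy_act (a * b) s.
Proof.
elim: s a b => [|x s IH] a b ab; last first.
  rewrite /= gheadM //; have [ab' <-] := gtailM x ab.
  by rewrite IH.
rewrite /=; have [->|b1] := eqVneq b 1; first by rewrite mulg1.
rewrite /= /ghead /gtail beta_perp // mulVg eqxx.
case: eqP => // /eqP; rewrite -len_eq0 ab addn_eq0 !len_eq0 (negPf b1).
by rewrite andbF.
Qed.

(** A word is greedy if multiplying by its first letter merely puts that letter in front. This also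
    excludes the letter 1, since [greedy_act 1] is the identity. *)
Fixpoint greedy s : Prop :=
  if s is x :: s' then greedy_act x s' = s /\ greedy s' else True.

(* With b = beta a x and q = b^-1 x, the head p = a b satisfies
   p (q s) = a (b (q s)) = a (x s) by the action law. *)
Lemma greedy_greedy_act a s : greedy s -> greedy (greedy_act a s).
Proof.
elim: s a => [|x s IH] a /=.
  by case: eqP => //= /eqP /negPf ->.
case=> xs ns; split; last exact: IH.
have [ab xb _] := beta_spec a x; rewrite {1}/ghead -greedy_actM //.
by rewrite (greedy_actM s (perp_quot xb)) mulKVg xs.
Qed.

(** A leading Delta lets any simple element absorb its whole complement: the head becomes Delta and
    the tail is the flipped element, as in relation 3. *)
Lemma greedy_act_w0_cons a s :
  greedy_act (flip a) (w0 n :: s) = w0 n :: greedy_act a s.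
Proof.
rewrite /= /ghead /gtail beta_w0r mulKVg invMg invgK w0V.
by rewrite flipE conjgE w0V -!mulgA w0K mulg1 mulgA w0K mul1g.
Qed.

End Greedy.

(** * The action of the braid group on the words Delta^-k x1...xm *)

Section States.
Local Open Scope group_scope.
Variable n : nat.
Hypothesis n_gt0 : 0 < n.
Implicit Types (a b c q x y z : 'S_n.+1) (s : seq 'S_n.+1).
Local Notation len a := (size (nf a)).

Lemma greedy_act_w0 s : greedy s -> greedy_act (w0 n) s = w0 n :: s.
Proof.
case: s => [|x s] /=; first by rewrite (negPf (w0_neq1 n_gt0)).
by case=> xs _; rewrite /ghead /gtail beta_w0l mulg1 invg1 mul1g xs.
Qed.

(* A state (k, s) stands for Delta^-k s with s a greedy normal form; it is
   valid if nothing cancels. *)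
Implicit Types (st : nat * seq 'S_n.+1).

(** Cancellation is confined to k = 0, since a valid state with k > 0 has no leading Delta. The
    default 1 of [head] is distinct from [w0] as n > 0. *)
Definition Delta_inv st : nat * seq 'S_n.+1 :=
  if (st.1 == 0) && (head 1 st.2 == w0 n) then (0, behead st.2)
  else (st.1.+1, st.2).

(** Moving [a] past one Delta^{-1} flips it; [Delta_inv] then restores that Delta^{-1}, cancelling
    it if the action has produced a leading Delta. *)
Fixpoint actS a k s : nat * seq 'S_n.+1 :=
  if k is k'.+1 then Delta_inv (actS (flip a) k' s) else (0, greedy_act a s).

Definition valid st := greedy st.2 /\ (0 < st.1 -> head 1 st.2 != w0 n).

Lemma valid_Delta_inv st : valid st -> valid (Delta_inv st).
Proof.
case: st => k s [/= ns hs]; rewrite /Delta_inv /=.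
case: ifP => [_|H]; first by split=> //; case: (s) ns => //= x s' [].
split=> //= _; case: k hs H => [|k] //=; last by move=> ->.
by move=> _ ->.
Qed.

Lemma valid_actS a k s : greedy s -> valid (actS a k s).
Proof.
elim: k a => [|k IH] a ns /=; last exact/valid_Delta_inv/IH.
by split=> //; apply: greedy_greedy_act.
Qed.

(** This is r(a) Delta^{-1} = Delta^{-1} r(flip a) on states. It holds by definition unless
    Delta^{-1} cancels a leading Delta, where [greedy_act_w0_cons] applies. *)
Lemma actS_Delta_inv a st :
  actS a (Delta_inv st).1 (Delta_inv st).2 = Delta_inv (actS (flip a) st.1 st.2).
Proof.
case: st => -[|k] s //; have [E|E] := eqVneq (head 1 s) (w0 n); last first.
  by rewrite {1 2}/Delta_inv /= (negPf E).
case: s E => [|x s] /= E; first by have := w0_neq1 n_gt0; rewrite -E eqxx.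
rewrite E; transitivity (Delta_inv (0, w0 n :: greedy_act a s)).
  by rewrite /Delta_inv /= !eqxx.
by rewrite -greedy_act_w0_cons.
Qed.

Lemma perp_flip a b : perp a b -> perp (flip a) (flip b).
Proof.
rewrite /perp => ab; have E := flipM a b.
by rewrite -E (len_flip (a * b)) (len_flip a) (len_flip b).
Qed.

Lemma actSM a b k s : perp a b ->
  actS a (actS b k s).1 (actS b k s).2 = actS (a * b) k s.
Proof.
elim: k a b => [|k IH] a b ab /=; first by rewrite greedy_actM.
by rewrite actS_Delta_inv (IH _ _ (perp_flip ab)) -flipM.
Qed.

Lemma actS1 k s : valid (k, s) -> actS 1 k s = (k, s).
Proof.
elim: k => [|k IH] [/= ns hs]; first by rewrite greedy_act1.
rewrite flip1 IH; last by split=> //= _; apply: hs.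
by rewrite /Delta_inv /= (negPf (hs _)) // andbF.
Qed.

Lemma Delta_inv_actS_w0 k s : valid (k, s) -> Delta_inv (actS (w0 n) k s) = (k, s).
Proof.
elim: k => [|k IH] [/= ns hs]; first by rewrite greedy_act_w0 // /Delta_inv /= eqxx.
rewrite flip_w0 IH; last by split=> //= _; apply: hs.
by rewrite /Delta_inv /= (negPf (hs _)) // andbF.
Qed.

Definition letter_act (x : letter n) st :=
  if x is Some a then actS (val a) st.1 st.2 else Delta_inv st.

Definition word_act (u : seq (letter n)) st := foldr letter_act st u.

Lemma word_act_cat u v st : word_act (u ++ v) st = word_act u (word_act v st).
Proof. exact: foldr_cat. Qed.

Lemma valid_word_act u st : valid st -> valid (word_act u st).
Proof.
move=> vst; elim: u => [|[a|] u IH] //=; last exact: valid_Delta_inv.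
by apply: valid_actS; case: IH.
Qed.

Lemma word_act_r a st : valid st -> word_act (r a) st = actS a st.1 st.2.
Proof.
rewrite /r; case: insubP => [x _ <-|/negPn/eqP->] //.
by case: st => k s /actS1 ->.
Qed.

Lemma word_act_Delta eps st : valid st ->
  word_act (Delta n eps) (word_act (Delta n (~~ eps)) st) = st.
Proof.
move=> vst; case: eps => /=; last first.
  rewrite -/(word_act (r _) _) word_act_r //.
  by case: st vst => k s; apply: Delta_inv_actS_w0.
rewrite -/(word_act (r _) _) word_act_r; last exact: valid_Delta_inv.
rewrite actS_Delta_inv flip_w0.
by case: st vst => k s; apply: Delta_inv_actS_w0.
Qed.

(** The state reached from the empty word is thus an invariant of the group element. Validity is
    carried along because cancelling Delta against Delta^{-1} may fail to act as the identity on
    other states. *)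
Lemma word_act_pres u v st : thue (@AT_pres n) u v -> valid st ->
  word_act u st = word_act v st.
Proof.
move=> uv; move: u v uv st.
apply: (@thue_sub _ _ (fun u v => forall st, valid st -> _ u st = _ v st)).
- move=> a b u v uv st vst; rewrite !word_act_cat uv //; exact: valid_word_act.
- by [].
- by move=> u v uv st vst; rewrite uv.
- by move=> u v w uv vw st vst; rewrite uv // vw.
move=> u v [eps|a b ab] st vst; rewrite word_act_cat.
  exact: word_act_Delta.
rewrite !word_act_r //.
  exact: actSM.
by rewrite -[actS _ _ _]word_act_r //; apply: valid_word_act.
Qed.

End States.

(** * The presentation and the basis *)

Section LetterOrder.
Variable n : nat.

Lemma letter_lt_irr : irreflexive (@letter_lt n).
Proof.
by case=> [a|] //=; rewrite ltnn eqxx lex_lt_irr // => i; apply: ltnn.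
Qed.

Lemma letter_lt_trans : transitive (@letter_lt n).
Proof.
move=> [b|] [a|] [c|] //=.
case/orP=> [ab|/andP[/eqP Eab ab]]; case/orP=> [bc|/andP[/eqP Ebc bc]].
- by rewrite (ltn_trans bc ab).
- by rewrite -Ebc ab.
- by rewrite Eab bc.
- rewrite Eab Ebc eqxx (lex_lt_trans _ ab bc) ?orbT //.
  by move=> j i k; apply: ltn_trans.
Qed.

Lemma letter_lt_total (x y : letter n) : x != y -> letter_lt x y || letter_lt y x.
Proof.
case: x y => [a|] [b|] // ab; rewrite /letter_lt.
case: (ltngtP (size (nf (val a))) (size (nf (val b)))) => //= _.
apply: lex_lt_total => [i j|]; first by rewrite -val_eqE /= neq_ltn.
apply: contraNneq ab => /nf_inj/val_inj ->; exact: eqxx.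
Qed.

End LetterOrder.

Section Presentation.
Local Open Scope group_scope.
Variable n : nat.
Hypothesis n_gt0 : 0 < n.
Implicit Types (a b c m : 'S_n.+1) (s : seq 'S_n.+1).
Local Notation len a := (size (nf a)).
Local Notation T := (thue (@AT_pres n)).
Local Notation B := (thue (@braid_rel n)).

Lemma r1 : r (1 : 'S_n.+1) = [::].
Proof. by rewrite /r insubF // eqxx. Qed.

Lemma r_neq1 a (a1 : a != 1) : r a = [:: Some (exist _ a a1)].
Proof. by rewrite /r insubT. Qed.

(** * The basis relations follow from the presentation *)

Lemma AT_mulE a b : perp a b -> T (r a ++ r b) (r (a * b)).
Proof. by move=> ab; apply: thue_rel; apply: AT_mul. Qed.

Lemma AT_invE eps : T (Delta n eps ++ Delta n (~~ eps)) [::].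
Proof. by apply: thue_rel; apply: AT_inv. Qed.

Lemma AT_shift a b c : perp a b -> perp b c ->
  T (r a ++ r (b * c)) (r (a * b) ++ r c).
Proof.
move=> ab bc; apply: (@thue_trans _ _ (r a ++ r b ++ r c)).
  by apply: thue_catl; apply: thue_sym; apply: AT_mulE.
by rewrite catA; apply: thue_catr; apply: AT_mulE.
Qed.

Lemma compl_flip a : a^-1 * w0 n * flip a = w0 n.
Proof.
rewrite flipE conjgE w0V mulgA -(mulgA a^-1) w0K.
by rewrite mulg1 mulgA mulVg mul1g.
Qed.

Lemma perp_compl a : perp a (a^-1 * w0 n).
Proof. exact: perp_quot (prefix_w0 a). Qed.

Lemma perp_compl_flip a : perp (a^-1 * w0 n) (flip a).
Proof.
have -> : flip a = (a^-1 * w0 n)^-1 * w0 n.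
  by apply: (mulgI (a^-1 * w0 n)); rewrite compl_flip mulKVg.
exact: perp_compl.
Qed.

(** With c = a^-1 w0, Delta factors both as a c and as c a', so shifting c from the second factor of
    r(a) r(c a') to the first gives Delta r(a'). *)
Lemma AT_Delta a eps : T (r a ++ Delta n eps) (Delta n eps ++ r (flip a)).
Proof.
have Dpos b : T (r b ++ r (w0 n)) (r (w0 n) ++ r (flip b)).
  have := AT_shift (perp_compl b) (perp_compl_flip b).
  by rewrite compl_flip mulKVg.
case: eps; first exact: Dpos.
(* For Delta^{-1}, the positive case at [flip a] is multiplied by Delta^{-1} on both sides. *)
apply: (@thue_trans _ _ (Delta n false ++ Delta n true ++ r a ++ Delta n false)).
  rewrite catA; apply: (thue_catr _ (u := [::])).
  by apply: thue_sym; apply: AT_invE.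
apply: (@thue_trans _ _
  (Delta n false ++ (r (flip a) ++ Delta n true) ++ Delta n false)).
  rewrite (catA (Delta n true)); apply: thue_ctx; apply: thue_sym.
  by have := Dpos (flip a); rewrite flipK.
rewrite -catA; apply: thue_catl; rewrite -[X in T _ X]cats0; apply: thue_catl.
exact: AT_invE.
Qed.

Lemma AT_basis_pres u v : AT_basis u v -> T u v.
Proof.
case=> [a b|a b c|a eps|a b c m ab bc cm Ebc|eps].
- exact: AT_mulE.
- exact: AT_shift.
- exact: AT_Delta.
(* Relation 4: both letters are split, the middle pair merges into Delta, and Delta moves to the
   front past r(a). *)
- apply: (@thue_trans _ _ ((r a ++ r b) ++ (r c ++ r m))).
    by apply: thue_cat; apply: thue_sym; apply: AT_mulE.
  apply: (@thue_trans _ _ ((r a ++ Delta n true) ++ r m)).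
    rewrite -!catA; apply: thue_catl; rewrite catA; apply: thue_catr.
    by rewrite -Ebc; apply: AT_mulE.
  by rewrite [X in T _ X]catA; apply: thue_catr; apply: AT_Delta.
- exact: AT_invE.
Qed.

Lemma thue_AT_basis u v : thue (@AT_basis n) u v -> T u v.
Proof.
move: u v; apply: thue_sub.
- by move=> a b u v; apply: thue_ctx.
- exact: thue_refl.
- by move=> u v; apply: thue_sym.
- by move=> u v w; apply: thue_trans.
- exact: AT_basis_pres.
Qed.

(** * Reduction to the greedy normal form *)

Local Notation lt := (deglex_lt (@letter_lt n)).
Local Notation red := (red (@letter_lt n) (@AT_basis n)).

Definition simple_word s : seq (letter n) := flatten [seq r a | a <- s].
Definition state_word (st : nat * seq 'S_n.+1) : seq (letter n) :=
  nseq st.1 None ++ simple_word st.2.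

(** Longer elements are smaller letters, so absorbing b lowers the first letter, and for c = 1 the
    degree falls. The assumption on a keeps r(a) from being empty, in which case the rule could
    split a letter and raise the degree. *)
Lemma red_shift a b c : a != 1 -> perp a b -> perp b c ->
  red (r a ++ r (b * c)) (r (a * b) ++ r c).
Proof.
move=> a1 ab bc; have [->|b1] := eqVneq b 1.
  by rewrite mul1g mulg1; apply: red_refl.
apply: red_rel; first exact: AT2.
have lb : 0 < len b by rewrite lt0n len_eq0.
have bc1 : b * c != 1 by rewrite -len_eq0 bc addn_eq0 len_eq0 (negPf b1).
have ab1 : a * b != 1 by rewrite -len_eq0 ab addn_eq0 len_eq0 (negPf a1).
rewrite (r_neq1 a1) (r_neq1 bc1) (r_neq1 ab1).
have [Ec|c1] := eqVneq c 1; first by have -> : r c = [::] by rewrite Ec r1.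
rewrite (r_neq1 c1) /deglex_lt /= ab -{1}[len a]addn0 ltn_add2l lb.
done.
Qed.

Lemma red_greedy_act a s : red (r a ++ simple_word s) (simple_word (greedy_act a s)).
Proof.
elim: s a => [|x s IH] a.
  rewrite /=; case: eqP => [->|_]; first by rewrite r1; apply: red_refl.
  exact: red_refl.
have [->|a1] := eqVneq a 1; first by rewrite greedy_act1 r1; apply: red_refl.
have [ab xb _] := beta_spec a x.
have := red_shift a1 ab (perp_quot xb); rewrite mulKVg.
rewrite /simple_word /= -/(simple_word s) -/(simple_word _).
move/(red_ctx [::] (simple_word s)) => /=; rewrite -!catA => H.
apply: (red_trans H); have := red_ctx (r (ghead a x)) [::] (IH (gtail a x)).
by rewrite !cats0.
Qed.

Lemma red_Delta_inv st : red (None :: state_word st) (state_word (Delta_inv st)).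
Proof.
case: st => -[|k] s; last exact: red_refl.
have [E|E] := eqVneq (head 1 s) (w0 n); last first.
  by rewrite /Delta_inv /= (negPf E); apply: red_refl.
case: s E => [|x s] /= E; first by have := w0_neq1 n_gt0; rewrite -E eqxx.
rewrite E /Delta_inv /= eqxx /state_word /=.
apply: (red_ctx [::] (simple_word s) (u := None :: r (w0 n)) (v := [::])).
by apply: red_rel; [exact: (AT5 n false)|].
Qed.

Lemma red_actS a k s : red (r a ++ state_word (k, s)) (state_word (actS a k s)).
Proof.
elim: k a => [|k IH] a; first exact: red_greedy_act.
rewrite /= ; apply: (red_trans _ (red_Delta_inv _)).
apply: (@red_trans _ _ _ (None :: (r (flip a) ++ state_word (k, s)))); last first.
  by have := red_ctx [:: None] [::] (IH (flip a)); rewrite !cats0.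
have [->|a1] := eqVneq a 1; first by rewrite flip1 r1; apply: red_refl.
have -> : r a ++ state_word (k.+1, s) = (r a ++ [:: None]) ++ state_word (k, s).
  by rewrite -catA.
apply: (red_ctx [::] (state_word (k, s))
   (u := r a ++ [:: None]) (v := None :: r (flip a))).
(* The step decreases because the least letter, Delta^{-1}, moves to the front. *)
apply: red_rel; first exact: (AT3 a false).
have fa1 : flip a != 1 by rewrite flip_eq1.
by rewrite (r_neq1 a1) (r_neq1 fa1).
Qed.

Lemma red_word_act u : red u (state_word (word_act u (0, [::]))).
Proof.
elim: u => [|x u IH]; first exact: red_refl.
apply: (@red_trans _ _ _ (x :: state_word (word_act u (0, [::])))).
  by have := red_ctx [:: x] [::] IH; rewrite !cats0.
rewrite /=; case: (word_act u _) => k s.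
case: x => [[a a1]|]; last exact: red_Delta_inv.
by have := red_actS a k s; rewrite (r_neq1 a1).
Qed.

Lemma AT_basis_confluent u v : thue (@AT_basis n) u v ->
  exists2 w, red u w & red v w.
Proof.
move/thue_AT_basis/(word_act_pres n_gt0) => /(_ (0, [::])) E.
exists (state_word (word_act u (0, [::]))); first exact: red_word_act.
by rewrite E //; apply: red_word_act.
Qed.

(** * The isomorphism with the braid group *)

Lemma braid_of_cat (u v : seq (letter n)) :
  braid_of (u ++ v) = braid_of u ++ braid_of v.
Proof. by rewrite /braid_of map_cat flatten_cat. Qed.

Lemma braid_of_r a : braid_of (r a) = pos (nf a).
Proof.
have [->|a1] := eqVneq a 1; last by rewrite (r_neq1 a1) /braid_of /= cats0.
by rewrite r1; have /eqP := len1 n; rewrite size_eq0 => /eqP ->.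
Qed.

Definition neg (w : seq 'I_n) := [seq (i, false) | i <- rev w].

Lemma braid_of_Deltainv : braid_of (Delta n false) = neg (nf (w0 n)).
Proof. by rewrite /braid_of /= cats0. Qed.

Section Inverses.
Variables (Y : Type) (R : seq Y -> seq Y -> Prop) (f : 'I_n * bool -> seq Y).
Hypothesis fK : forall i e, thue R (f (i, e) ++ f (i, ~~ e)) [::].
Local Notation F w := (flatten [seq f x | x <- w]).

(** The map f serves twice: as the inclusion of letters into braid words, and as
    [of_braid_letter]. *)
Lemma pos_negK w : thue R (F (pos w) ++ F (neg w)) [::].
Proof.
elim: w => [|i w IH]; first exact: thue_refl.
rewrite /neg rev_cons -cats1 !map_cat flatten_cat /= cats0 -!catA.
rewrite (catA (F (pos w))).
apply: thue_trans (fK i true); apply: thue_catl.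
exact: (thue_catr (f (i, false)) IH).
Qed.

Lemma neg_posK w : thue R (F (neg w) ++ F (pos w)) [::].
Proof.
elim: w => [|i w IH]; first exact: thue_refl.
rewrite /neg rev_cons -cats1 !map_cat flatten_cat /= cats0 -!catA.
apply: thue_trans IH; apply: thue_catl; rewrite catA.
exact: (thue_catr _ (fK i false)).
Qed.

End Inverses.

Lemma braid_inv i e : B ([:: (i, e)] ++ [:: (i, ~~ e)]) [::].
Proof. by apply: thue_rel; apply: BraidInv. Qed.

Lemma flatten_letters (Y : Type) (w : seq Y) : flatten [seq [:: x] | x <- w] = w.
Proof. by elim: w => //= x w ->. Qed.

Lemma braid_of_thue u v : T u v -> B (braid_of u) (braid_of v).
Proof.
move: u v; apply: thue_morph => u v [eps|a b ab].
  rewrite -/(braid_of _) braid_of_cat.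
  have P := @pos_negK _ _ (fun x => [:: x]) braid_inv (nf (w0 n)).
  have N := @neg_posK _ _ (fun x => [:: x]) braid_inv (nf (w0 n)).
  rewrite !flatten_letters in P N.
  by case: eps => /=; rewrite ?braid_of_Deltainv braid_of_r.
rewrite -!/(braid_of _) braid_of_cat !braid_of_r /pos -map_cat.
apply: reduced_braid; first by rewrite /reduced word_perm_cat !nfK size_cat ab.
  exact: reduced_nf.
by rewrite word_perm_cat !nfK.
Qed.

(** An inverse of r(a), obtained from Delta = r(a) r(a^-1 w0). *)
Definition r_inv a : seq (letter n) := r (a^-1 * w0 n) ++ Delta n false.

Lemma r_invr a : T (r a ++ r_inv a) [::].
Proof.
apply: thue_trans (AT_invE true); rewrite catA; apply: thue_catr.
by have := AT_mulE (perp_compl a); rewrite mulKVg.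
Qed.

Lemma r_invl a : T (r_inv a ++ r a) [::].
Proof.
apply: thue_trans (AT_invE true).
apply: (@thue_trans _ _ (r (a^-1 * w0 n) ++ r (flip a) ++ Delta n false)).
  rewrite -catA; apply: thue_catl; apply: thue_sym.
  by have := AT_Delta (flip a) false; rewrite flipK.
rewrite catA; apply: thue_catr.
by have := AT_mulE (perp_compl_flip a); rewrite compl_flip.
Qed.

Definition of_braid_letter (x : 'I_n * bool) : seq (letter n) :=
  if x.2 then r (gen x.1) else r_inv (gen x.1).
Definition of_braid w := flatten [seq of_braid_letter x | x <- w].

Lemma of_braid_inv i e :
  T (of_braid_letter (i, e) ++ of_braid_letter (i, ~~ e)) [::].
Proof. by case: e; [apply: r_invr|apply: r_invl]. Qed.

Lemma of_braid_pos w : reduced w -> T (of_braid (pos w)) (r (word_perm w)).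
Proof.
elim: w => [|i w IH]; first by rewrite word_perm_nil r1 => _; apply: thue_refl.
move=> /reduced_cons[rw iw]; rewrite word_perm_cons.
apply: (thue_trans (thue_catl (r (gen i)) (IH rw))).
by apply: AT_mulE; have := perp_quot iw; rewrite word_perm_cons mulKg.
Qed.

(** Both sides of a positive braid relation are reduced words for the same permutation, so both map
    to its single letter. Reducedness comes from the join lemmas at [w0], of which every generator
    is a prefix. *)
Lemma of_braid_thue u v : B u v -> T (of_braid u) (of_braid v).
Proof.
have same w w' : reduced w -> reduced w' -> word_perm w = word_perm w' ->
    T (of_braid (pos w)) (of_braid (pos w')).
  move=> rw rw' E; apply: (thue_trans (of_braid_pos rw)).
  by rewrite E; apply/thue_sym/of_braid_pos.
move: u v; apply: thue_morph => u v [i e|i j ij|i j Ej].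
- by rewrite /= cats0; apply: of_braid_inv.
- have [E /(_ _ (prefix_w0 _) (prefix_w0 _))[ri _]] := join_comm ij.
  by apply: (same [:: j; i] [:: i; j]) => //; rewrite /reduced -E ri.
- have [E /(_ _ (prefix_w0 _) (prefix_w0 _))[ri _]] := join_braid Ej.
  by apply: (same [:: j; i; j] [:: i; j; i]) => //; rewrite /reduced -E ri.
Qed.

Lemma of_braid_cat u v : of_braid (u ++ v) = of_braid u ++ of_braid v.
Proof. by rewrite /of_braid map_cat flatten_cat. Qed.

Lemma of_braidK u : T (of_braid (braid_of u)) u.
Proof.
elim: u => [|x u IH]; first exact: thue_refl.
rewrite -cat1s braid_of_cat of_braid_cat; apply: thue_cat IH.
case: x => [[a a1]|]; first rewrite -(r_neq1 a1) braid_of_r -{2}(nfK a).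
  exact/of_braid_pos/reduced_nf.
rewrite (braid_of_Deltainv : braid_of [:: None] = _).
set w := nf (w0 n).
(* Inserting Delta^{-1} Delta and spelling Delta as the positive word w lets w cancel against its
   formal inverse. *)
apply: (@thue_trans _ _ ((Delta n false ++ Delta n true) ++ of_braid (neg w))).
  by apply: thue_sym; apply: (thue_catr _ (AT_invE false)).
rewrite -catA -[X in T _ X]cats0; apply: thue_catl.
apply: thue_trans (pos_negK of_braid_inv w); apply: thue_catr.
by apply: thue_sym; have := of_braid_pos (reduced_nf (w0 n)); rewrite nfK.
Qed.

Lemma braid_ofK w : B (braid_of (of_braid w)) w.
Proof.
elim: w => [|[i e] w IH]; first exact: thue_refl.
rewrite -cat1s of_braid_cat braid_of_cat; apply: thue_cat IH.
rewrite {1}/of_braid /= cats0.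
have Bpos : B (braid_of (r (gen i))) [:: (i, true)].
  rewrite braid_of_r; apply: (@reduced_braid _ (nf (gen i)) [:: i]).
  - exact: reduced_nf.
  - by rewrite /reduced word_perm_cons word_perm_nil mulg1 len_gen.
  - by rewrite nfK word_perm_cons word_perm_nil mulg1.
case: e; first exact: Bpos.
have := braid_of_thue (r_invl (gen i)); rewrite braid_of_cat => H.
set X := braid_of (r_inv _) in H *.
(* Uniqueness of inverses: X and sigma_i^{-1} are both inverse to sigma_i, which is the image of
   r(s_i). *)
apply: (@thue_trans _ _ (X ++ [:: (i, true); (i, false)])).
  rewrite -{1}[X]cats0; apply: thue_catl; apply: thue_sym.
  exact: braid_inv true.
apply: (@thue_trans _ _ ((X ++ braid_of (r (gen i))) ++ [:: (i, false)])).
  rewrite -catA; apply: thue_catl.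
  by apply: thue_sym; apply: (thue_catr [:: (i, false)] Bpos).
exact: (thue_catr [:: (i, false)] H).
Qed.

Lemma AT_presents_braid_group : presents_braid_group (@AT_pres n).
Proof.
split=> [u v|w]; last by exists (of_braid w); apply: braid_ofK.
split; first exact: braid_of_thue.
move/of_braid_thue => H; apply: (thue_trans (thue_sym (of_braidK u))).
exact: thue_trans H (of_braidK v).
Qed.

End Presentation.

Theorem theorem2p7 (F : fieldType) (n : nat) (hn : 0 < n) :
  presents_braid_group (@AT_pres n) /\
  GS_basis_of F (deglex_lt (@letter_lt n)) (@AT_pres n) (@AT_basis n).
Proof.
split; first exact: AT_presents_braid_group.
have irr := @letter_lt_irr n; have tr := @letter_lt_trans n.
have tot := @letter_lt_total n.
split.
- by apply: GS_basis_confluent => // u v; apply: AT_basis_confluent.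
- move=> f [u [v [Ruv uv /= ->]]]; exists u, v; split=> //.
  by case: Ruv => [eps|a b ab]; [apply: AT5|apply: AT1].
(* The ideal does not grow, because every basis relation already holds in the presentation. *)
move=> f /(rel_polysP irr tr tot)[l [r [Rlr _ ->]]].
apply: ideal_thue => //; case: Rlr => [|/AT_basis_pres/thue_sym//].
exact: AT_basis_pres.
Qed.
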